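(* Fix an integer $d\ge 1$. There is a function $\varepsilon_d(N)\to 0$ as $N\to\infty$ such that for every finite hypergraph $H=(V,E)$ in which every edge has at most $d$ vertices, there is a non-adaptive group testing algorithm that identifies the defective edge using at most $d\log_2 e\,\log_2|E|\,(1+\varepsilon_d(|E|))$ tests, where $e$ in $\log_2 e$ denotes Euler's number. *)

(* Defs.v *)
From HB Require Import structures.
From mathcomp Require Import all_boot all_order all_algebra.
From mathcomp Require Import all_classical all_reals.
From mathcomp Require Import topology normedtype sequences exp.
Set Implicit Arguments. Unset Strict Implicit. Unset Printing Implicit Defensive.
Import Order.TTheory GRing.Theory Num.Theory.
Local Open Scope ring_scope.

Definition log2 {R : realType} (x : R) : R := ln x / ln 2.

(* A hypergraph on the finite vertex type V is a set E of edges (vertex sets).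
   The defective edge is some unknown e* \in E.  A test is a vertex set T;
   it answers positively iff the defective edge is contained in T
   (Aigner's model; equivalently, via complementation, iff e* meets V \ T).
   A non-adaptive algorithm is a fixed list of tests; it identifies the
   defective edge iff distinct edges give distinct answer vectors. *)
Definition test_outcome (V : finType) (T e : {set V}) : bool := e \subset T.

Definition identifies (V : finType) (E : {set {set V}}) (tests : seq {set V}) : Prop :=
  forall e1 e2, e1 \in E -> e2 \in E ->
    (forall T, T \in tests -> test_outcome T e1 = test_outcome T e2) -> e1 = e2.

(* Main.v *)
Require Import Defs.
From mathcomp Require Import all_boot all_order all_algebra.
From mathcomp Require Import ring lra zify.
Import Order.TTheory GRing.Theory Num.Theory.
Local Open Scope ring_scope.

(* Write l for ln 2 and N for the number of edges; the bound is (d / l^2) ln N (1 + o(1)).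

   A block of m tests is given by a map g : V -> 'I_m; its tests are the sets of the v with
   g v <> a, and together their outcomes reveal exactly the image g(e) of the defective edge.
   For rank d >= 3 we take kap ln N random blocks, with the average number of unseparated pairs
   (e, f), |e| <= |f|, kept below 1.  Let th be the probability that one vertex hits the image
   of d - 1 others.
   - If f = e + v, a block fails with probability at most th; there are at most d N such pairs.
   - If f has two vertices outside e, a block fails with probability at most th^2, which
     balances the N^2 pairs.
   - If e = C + x and f = C + y, a block fails with probability s slightly above th^2, too much
     for N^2 pairs.  Let W be the set of vertices of degree more than N^(1-r).  If x and y are
     in W, or C is not contained in W, there are far fewer than N^2 pairs; otherwise x and y are
     separated by random tests containing W, of which a small multiple of ln N suffices.
   With m close to (d - 1) / l, so that th is close to 1/2, th (1 - th) <= 1/4 gives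
   - ln th >= 2 l - (d - 1) (- ln (1 - 1/m)), and the total stays below (d / l^2) ln N because
     only d - 1 vertices enter th.

   For d = 2 ternary codes are chosen greedily: two edges sharing a vertex are separated as
   soon as the code is injective, and an edge {v, w} collides with {a, b} for at most one code
   of v, so 3^k > N sqrt(2 N) + 2 N suffices when vertices are removed by minimal degree.
   For d = 1 binary codes of the edges suffice. *)

(** * Derandomized sampling *)

Lemma sum_nat_indicator (T : finType) (B : {set T}) : (\sum_t (t \in B) = #|B|)%N.
Proof. by rewrite -sum1_card [RHS]big_mkcond; apply: eq_bigr => t _; case: ifP. Qed.

Section Derandomization.
Variables (R : realFieldType) (T P : finType) (C : P -> {set T}) (a : P -> R).
Hypothesis T_gt0 : (0 < #|T|)%N.
Hypothesis a_ge0 : forall p, 0 <= a p.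
Hypothesis card_C : forall p, #|C p|%:R <= a p * #|T|%:R.

(** First moment: by [card_C] the mean over [t] of the left side is at most the right side, so not
    every [t] can exceed it. *)
Lemma exists_below_average (w : P -> R) : (forall p, 0 <= w p) ->
  exists t, \sum_p w p * (t \in C p)%:R <= \sum_p w p * a p.
Proof.
move=> w_ge0.
case: (pickP (fun t => \sum_p w p * (t \in C p)%:R <= \sum_p w p * a p)) => [t ht|h].
  by exists t.
exfalso.
have : \sum_(t : T) \sum_p w p * (t \in C p)%:R <= \sum_(t : T) \sum_p w p * a p.
  rewrite exchange_big [leRHS]exchange_big /=; apply: ler_sum => p _.
  rewrite -mulr_sumr -natr_sum sum_nat_indicator sumr_const -[leRHS]mulr_natr -mulrA.
  by apply: ler_wpM2l; rewrite // card_C.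
apply/negP; rewrite -ltNge; have [t0 _] := card_gt0P T_gt0.
rewrite (bigD1 t0) //= [ltRHS](bigD1 t0) //=; apply: ltr_leD.
  by have := h t0; rewrite leNgt => /negbFE.
by apply: ler_sum => t _; have := h t; rewrite leNgt => /negbFE/ltW.
Qed.

(** Method of conditional expectations: the samples are fixed one at a time, and each chosen [t]
    restricts the weights to the [p] with [t \in C p]. *)
Lemma exists_seq_below_average (k : nat) (w : P -> R) : (forall p, 0 <= w p) ->
  exists s : seq T, size s = k /\
    \sum_p w p * (all (fun t => t \in C p) s)%:R <= \sum_p w p * a p ^+ k.
Proof.
elim: k w => [|k IHk] w w_ge0.
  by exists [::]; split=> //; apply: ler_sum => p _; rewrite expr0.
(* The factor [a p ^+ k] bounds the probability that the [k] samples still to come all lie in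
   [C p]. *)
have [p|t ht] := exists_below_average (fun p => w p * a p ^+ k).
  by rewrite mulr_ge0 ?exprn_ge0.
have [p|s [szs hs]] := IHk (fun p => w p * (t \in C p)%:R).
  by rewrite mulr_ge0 ?ler0n.
exists (t :: s); split; rewrite /= ?szs //.
rewrite [leLHS](eq_bigr (fun p => w p * (t \in C p)%:R *
  (all (fun t => t \in C p) s)%:R)) => [|p _]; last by rewrite -mulrA -natrM mulnb.
apply: (le_trans hs).
rewrite [leRHS](eq_bigr (fun p => w p * a p ^+ k * a p)) => [|p _]; last first.
  by rewrite exprSr mulrA.
rewrite [leLHS](eq_bigr (fun p => w p * a p ^+ k * (t \in C p)%:R)) => [//|p _].
by rewrite /= mulrAC.
Qed.

End Derandomization.

(** * Resampling the values of a random map *)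

Section Resampling.
Variables (V A : finType).
Implicit Types (g : {ffun V -> A}) (S : {set V}).

Definition update g v b : {ffun V -> A} := [ffun u => if u == v then b else g u].

Lemma update_notin_imset g v b S : v \notin S -> update g v b @: S = g @: S.
Proof.
move=> vS; apply: eq_in_imset => u uS; rewrite ffunE.
by case: eqP => // uv; rewrite -uv uS in vS.
Qed.

(** Exchanging [g v] with a letter [b] is an involution on the pairs [(g, b)], so [g v] may be
    replaced by an independent uniform letter when [F] ignores the value of its map at [v]. *)
Lemma sum_resample v (F : A -> {ffun V -> A} -> nat) :
  (forall b g c, F b (update g v c) = F b g) ->
  (#|A| * \sum_(g : {ffun V -> A}) F (g v) g = \sum_(g : {ffun V -> A}) \sum_b F b g)%N.
Proof.
move=> Fv; rewrite pair_bigA /= big_distrr /=.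
pose h (x : {ffun V -> A} * A) := (update x.1 v x.2, x.1 v).
have hK : involutive h.
  case=> g b; rewrite /h /=; congr pair; last by rewrite ffunE eqxx.
  by apply/ffunP => u; rewrite !ffunE; case: eqP => [->|].
rewrite [RHS](reindex_inj (inv_inj hK)) /=.
rewrite -(pair_bigA _ (fun g b => F (g v) (update g v b))) /=.
rewrite [RHS](eq_bigr (fun g => \sum_(b : A) F (g v) g)%N); last first.
  by move=> g _; apply: eq_bigr => b _; rewrite Fv.
by apply: eq_bigr => g _; rewrite sum_nat_const.
Qed.

Lemma sum_resample2 x y (F : A -> A -> {ffun V -> A} -> nat) : x != y ->
  (forall a b g c, F a b (update g x c) = F a b g) ->
  (forall a b g c, F a b (update g y c) = F a b g) ->
  (#|A| ^ 2 * \sum_(g : {ffun V -> A}) F (g x) (g y) g = \sum_(g : {ffun V -> A}) \sum_a \sum_b F a b g)%N.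
Proof.
move=> xy Fx Fy; rewrite -mulnn -mulnA.
rewrite (sum_resample x (fun a g => F a (g y) g)); last first.
  by move=> a g c; rewrite ffunE eq_sym (negPf xy) Fx.
rewrite exchange_big /= big_distrr /= [RHS]exchange_big /=.
by apply: eq_bigr => a _; rewrite (sum_resample y (F a)).
Qed.

Lemma card_avoiding S (B : {set A}) :
  #|[set g : {ffun V -> A} | [disjoint g @: S & B]]| =
  ((#|A| - #|B|) ^ #|S| * #|A| ^ (#|V| - #|S|))%N.
Proof.
pose F (v : V) : pred A := [pred b | (v \in S) ==> (b \notin B)].
have -> : #|[set g : {ffun V -> A} | [disjoint g @: S & B]]| = #|family F|.
  apply: eq_card => g; rewrite !inE; apply/idP/forallP => [dis v|h].
    rewrite inE; apply/implyP => vS.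
    by rewrite (disjointFr dis) ?imset_f.
  apply/pred0P => b /=; apply/negP => /andP[/imsetP[v vS ->]].
  by have := h v; rewrite inE vS => /negP.
rewrite card_family foldrE big_map big_enum /=.
rewrite (bigID (mem S)) /=; congr (_ * _)%N.
  rewrite (eq_bigr (fun=> #|A| - #|B|)%N) ?prod_nat_const // => v vS.
  rewrite -[in RHS](cardsC B) addKn; apply: eq_card => b.
  by rewrite !inE vS.
rewrite (eq_bigr (fun=> #|A|)) => [|v vS].
  by rewrite prod_nat_const -(cardsC S) addKn; congr (_ ^ _)%N; apply: eq_card => v; rewrite !inE.
by apply: eq_card => b; rewrite !inE (negPf vS).
Qed.

End Resampling.

(** * Collisions in a random block *)

Section HitProbabilities.
Variable R : realFieldType.
Implicit Types (q : R) (c : nat).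

(** Probabilities for a random map from [c] vertices to [q] letters: [hit1] that a given letter
    occurs, [hit2] that two given distinct letters both occur, by inclusion-exclusion. *)
Definition hit1 q c : R := 1 - (1 - q^-1) ^+ c.
Definition hit2 q c : R := 1 - 2 * (1 - q^-1) ^+ c + (1 - 2 / q) ^+ c.

Lemma hit1_mono q c c' : 1 <= q -> (c <= c')%N -> hit1 q c <= hit1 q c'.
Proof.
move=> q1 cc; rewrite /hit1 lerB // ler_wiXn2l //.
- by rewrite subr_ge0 invf_le1 // (lt_le_trans ltr01).
- by rewrite gerBl invr_ge0 (le_trans ler01).
Qed.

(** One more vertex increases [hit2] by [2 q^-1 (a ^+ c - b ^+ c)], where [a = 1 - 1/q] and
    [b = 1 - 2/q]; [q >= 2] keeps [b] nonnegative. *)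
Lemma hit2_mono q c c' : 2 <= q -> (c <= c')%N -> hit2 q c <= hit2 q c'.
Proof.
move=> q2 /subnK <-; have q0 : 0 < q by rewrite (lt_le_trans _ q2).
elim: (c' - c)%N => //= n IH; apply: (le_trans IH); rewrite addSn.
rewrite /hit2 !exprS; set a := (1 - q^-1); set b := 1 - 2 / q.
have b0 : 0 <= b by rewrite subr_ge0 ler_pdivrMr // mul1r.
have ba : b <= a by rewrite /b /a; have := invr_gt0 q; rewrite q0; lra.
have := lerXn2r (n + c) b0 (le_trans b0 ba) ba.
have [ea eb] : a = 1 - q^-1 /\ b = 1 - 2 * q^-1 by [].
have := invr_gt0 q; rewrite q0; clearbody a b.
move: (a ^+ _) (b ^+ _) => X Y qi XY.
have : 0 <= q^-1 * (X - Y) by rewrite mulr_ge0 ?subr_ge0 // ltW.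
rewrite ea eb; lra.
Qed.

End HitProbabilities.

Arguments hit1 {R}.
Arguments hit2 {R}.

Section BlockCollisions.
Variables (R : realFieldType) (V A : finType).
Hypothesis A_gt1 : (1 < #|A|)%N.
Implicit Types (g : {ffun V -> A}) (S e : {set V}).
Let q : R := #|A|%:R.
Let T : R := #|{ffun V -> A}|%:R.

Let q_gt1 : 1 < q. Proof. by rewrite ltr1n. Qed.
Let q_ge2 : 2 <= q. Proof. by rewrite ler_nat. Qed.
Let q_gt0 : 0 < q. Proof. exact: lt_trans ltr01 q_gt1. Qed.
Let q_neq0 : q != 0. Proof. by rewrite gt_eqF. Qed.

Lemma card_set_sum (U : finType) (P : pred U) :
  #|[set x | P x]|%:R = \sum_x (P x)%:R :> R.
Proof.
by rewrite -sum_nat_indicator natr_sum; apply: eq_bigr => x _; rewrite inE.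
Qed.

Lemma sum_avoiding S (B : {set A}) :
  \sum_(g : {ffun V -> A}) [disjoint g @: S & B]%:R = (1 - #|B|%:R / q) ^+ #|S| * T.
Proof.
rewrite -card_set_sum card_avoiding /T card_ffun natrM !natrX natrB ?max_card //.
have -> : (1 - #|B|%:R / q) = (q - #|B|%:R) / q by field.
rewrite exprMn exprVn -mulrA; congr (_ * _); apply: (canRL (mulKf _)).
  by rewrite expf_neq0.
by rewrite -exprD subnKC ?max_card.
Qed.

Lemma sum_hit1 S b :
  \sum_(g : {ffun V -> A}) (b \in g @: S)%:R = hit1 q #|S| * T.
Proof.
rewrite (eq_bigr (fun g : {ffun V -> A} => 1 - [disjoint g @: S & [set b]]%:R)) => [|g _].
  by rewrite sumrB sum_avoiding sumr_const cards1 div1r /hit1 -/T mulrBl mul1r.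
by rewrite disjoint_sym disjoints1; case: (b \in _); rewrite ?subr0 ?subrr.
Qed.

Lemma sum_hit2 S b c : b != c ->
  \sum_(g : {ffun V -> A}) ((b \in g @: S) && (c \in g @: S))%:R = hit2 q #|S| * T.
Proof.
move=> bc; rewrite (eq_bigr (fun g : {ffun V -> A} =>
  1 - [disjoint g @: S & [set b]]%:R - [disjoint g @: S & [set c]]%:R
    + [disjoint g @: S & [set b; c]]%:R)) => [|g _].
  rewrite big_split /= !sumrB !sum_avoiding sumr_const !cards1 cards2 bc /hit2 -/T.
  by rewrite div1r; ring.
have dis (B : {set A}) : [disjoint g @: S & B] = [disjoint B & g @: S].
  by rewrite disjoint_sym.
rewrite !{}dis !disjoints1 disjoints_subset subUset !sub1set !inE.
by case: (b \in _); case: (c \in _) => /=; ring.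
Qed.

Lemma sum_hit1_le S b c : (#|S| <= c)%N ->
  \sum_(g : {ffun V -> A}) (b \in g @: S)%:R <= hit1 q c * T.
Proof.
move=> Sc; rewrite sum_hit1 ler_wpM2r ?ler0n // hit1_mono // ltW //.
Qed.

Lemma sum_hit2_le S b b' c : b != b' -> (#|S| <= c)%N ->
  \sum_(g : {ffun V -> A}) ((b \in g @: S) && (b' \in g @: S))%:R <= hit2 q c * T.
Proof.
by move=> bb Sc; rewrite sum_hit2 // ler_wpM2r ?ler0n // hit2_mono.
Qed.

(** As [v] lies outside [S], the letter [g v] is uniform and independent of [g @: S]. *)
Lemma card_hit_vertex v S c : v \notin S -> (#|S| <= c)%N ->
  #|[set g : {ffun V -> A} | g v \in g @: S]|%:R <= hit1 q c * T.
Proof.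
move=> vS Sc; rewrite card_set_sum -natr_sum -(ler_pM2l q_gt0) -natrM.
rewrite (sum_resample _ _ v (fun b g => nat_of_bool (b \in g @: S))); last first.
  by move=> b g b'; rewrite update_notin_imset.
rewrite exchange_big natr_sum /=.
apply: (le_trans (y := \sum_(b : A) hit1 q c * T)).
  by apply: ler_sum => b _; rewrite natr_sum sum_hit1_le.
by rewrite sumr_const -mulr_natl.
Qed.

Lemma sum_pairs_eq (h : A -> A -> R) x y :
  (forall a, h a a = x) -> (forall a b, a != b -> h a b = y) ->
  \sum_a \sum_b h a b = q * x + q * (q - 1) * y.
Proof.
move=> hx hy; rewrite (eq_bigr (fun=> x + (q - 1) * y)) => [|a _].
  by rewrite sumr_const -mulr_natl mulrDr mulrA.
rewrite (bigD1 a) //= hx (eq_bigr (fun=> y)) => [|b ba]; last by rewrite hy // eq_sym.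
by rewrite sumr_const cardC1 -mulr_natl -subn1 natrB // ltnW.
Qed.

(** The square counts ordered pairs of letters that both occur; [q] pairs of letters are diagonal
    and [q (q - 1)] are not. *)
Lemma sum_pairs_hit_le S c : (#|S| <= c)%N ->
  \sum_(g : {ffun V -> A}) (#|g @: S| ^ 2)%:R <= (q * hit1 q c + q * (q - 1) * hit2 q c) * T.
Proof.
move=> Sc.
rewrite (eq_bigr (fun g : {ffun V -> A} =>
    \sum_a \sum_b ((a \in g @: S) && (b \in g @: S))%:R)) => [|g _].
  rewrite exchange_big /=; under eq_bigr do rewrite exchange_big /=.
  have -> : (q * hit1 q c + q * (q - 1) * hit2 q c) * T =
    q * (hit1 q c * T) + q * (q - 1) * (hit2 q c * T) by ring.
  rewrite -(sum_pairs_eq (fun a b => if a == b then hit1 q c * T else hit2 q c * T)).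
  - apply: ler_sum => a _; apply: ler_sum => b _; case: eqVneq => [<-|ab]; last exact: sum_hit2_le.
    by under eq_bigr do rewrite andbb; exact: sum_hit1_le.
  - by move=> a; rewrite eqxx.
  - by move=> a b /negPf ->.
rewrite -mulnn natrM -sum_nat_indicator natr_sum mulr_suml; apply: eq_bigr => a _.
by rewrite mulr_sumr; apply: eq_bigr => b _; rewrite -natrM mulnb.
Qed.

(** A collision forces either [g x = g y], of probability [q^-1], or both letters to occur in
    [g @: S]. *)
Lemma card_swap_collision x y S c : x != y -> x \notin S -> y \notin S -> (#|S| <= c)%N ->
  #|[set g : {ffun V -> A} | g @: (x |: S) == g @: (y |: S)]|%:R
    <= (q^-1 + (1 - q^-1) * hit2 q c) * T.
Proof.
move=> xy xS yS Sc.
pose F a b (g : {ffun V -> A}) := nat_of_bool ((a == b) || ((a \in g @: S) && (b \in g @: S))).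
apply: (le_trans (y := (\sum_(g : {ffun V -> A}) F (g x) (g y) g)%:R)).
  rewrite card_set_sum natr_sum; apply: ler_sum => g _; rewrite ler_nat /F.
  case: eqP => //=; rewrite !imsetU1 lt0b => eqg.
  have : g x \in g y |: g @: S by rewrite -eqg setU11.
  have : g y \in g x |: g @: S by rewrite eqg setU11.
  by rewrite !inE eq_sym; case: eqP => //= _ -> ->.
have q2 : 0 < q ^+ 2 by rewrite exprn_gt0.
rewrite -(ler_pM2l q2) -natrX -natrM sum_resample2 //; last 2 first.
- by move=> a b g a'; rewrite /F update_notin_imset.
- by move=> a b g a'; rewrite /F update_notin_imset.
rewrite exchange_big /=; under eq_bigr do rewrite exchange_big /=.
rewrite natr_sum; under eq_bigr do rewrite natr_sum.
have -> : (#|A| ^ 2)%:R * ((q^-1 + (1 - q^-1) * hit2 q c) * T) = q * T + q * (q - 1) * (hit2 q c * T).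
  by rewrite natrX -/q; field.
rewrite -(sum_pairs_eq (fun a b => if a == b then T else hit2 q c * T)).
- apply: ler_sum => a _; apply: ler_sum => b _; rewrite natr_sum /F; case: eqVneq => [<-|ab].
    by rewrite /= sumr_const.
  exact: sum_hit2_le.
- by move=> a; rewrite eqxx.
- by move=> a b /negPf ->.
Qed.

(** The cases go by the letters of [G] outside [F]: with none, both [a] and [b] lie in [F]; with
    exactly one there are at most [2 #|F| + 1 <= #|F| ^ 2 + 2] pairs; with two or more, only the two
    orders of one pair remain. *)
Lemma card_completing_pairs (F G : {set A}) :
  (\sum_a \sum_b (G == a |: (b |: F)) <= #|F| ^ 2 + 2)%N.
Proof.
pose Z := finset (fun p : A * A => G == p.1 |: (p.2 |: F)).
have -> : (\sum_a \sum_b (G == a |: (b |: F)) = #|Z|)%N.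
  by rewrite pair_bigA -sum_nat_indicator; apply: eq_bigr => p _; rewrite inE.
have [eqGF|neqGF] := eqVneq G F.
  apply: (leq_trans (n := #|setX F F|)); last by rewrite cardsX mulnn leq_addr.
  apply: subset_leq_card; apply/subsetP => -[a b]; rewrite !inE /= eqGF => /eqP ->.
  by rewrite !inE !eqxx ?orbT.
have [->|[[a0 b0]]] := set_0Vmem Z; first by rewrite cards0.
rewrite inE /= => /eqP G0.
have subFG : F \subset G by rewrite G0 setUA subsetUr.
have [j jG jF] : exists2 j, j \in G & j \notin F.
  by apply/subsetPn; move: neqGF; rewrite eqEsubset subFG andbT.
have inG a b c : (a, b) \in Z -> (c \in G) = [|| c == a, c == b | c \in F].
  by rewrite inE /= => /eqP ->; rewrite !inE.
have [uniqj|] := boolP [forall c in G, (c == j) || (c \in F)].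
  apply: (leq_trans (n := #|[set (j, c) | c in j |: F] :|: [set (c, j) | c in F]|)).
    apply: subset_leq_card; apply/subsetP => -[a b] abZ.
    have aG : a \in G by rewrite (inG _ _ _ abZ) eqxx.
    have bG : b \in G by rewrite (inG _ _ _ abZ) eqxx orbT.
    move/forall_inP: uniqj => u.
    have := jG; rewrite (inG _ _ _ abZ) (negPf jF) orbF => jab.
    rewrite inE; have [aj|aj] := eqVneq a j.
      by rewrite aj imset_f //= !inE u.
    have jb : b = j by move: jab; rewrite eq_sym (negPf aj) => /eqP.
    apply/orP; right; rewrite jb imset_f //.
    by have := u _ aG; rewrite (negPf aj).
  apply: (leq_trans (leq_card_setU _ _)).
  apply: (leq_trans (leq_add (leq_imset_card _ _) (leq_imset_card _ _))).
  rewrite cardsU1 jF; nia.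
move=> /forall_inPn /= [j' j'G]; rewrite negb_or => /andP[j'j j'F].
apply: (leq_trans (n := #|[set (j, j'); (j', j)]|)); last first.
  by rewrite cards2; case: eqP => _; lia.
apply: subset_leq_card; apply/subsetP => -[a b] abZ.
have := jG; have := j'G; rewrite !(inG _ _ _ abZ) (negPf jF) (negPf j'F) !orbF !inE !xpair_eqE.
rewrite !(eq_sym a) !(eq_sym b).
by case/orP=> /eqP e1; case/orP=> /eqP e2; move: j'j; rewrite ?e1 ?e2 ?eqxx ?orbT.
Qed.

(** Once [g] is fixed off [x] and [y], so are [g @: e] and [g @: S], and [card_completing_pairs]
    bounds the colliding values of [(g x, g y)] among all [q ^ 2]. The bound is then averaged over
    [g]. *)
Lemma card_big_collision x y S e c : x != y -> x \notin S -> y \notin S ->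
  x \notin e -> y \notin e -> (#|S| <= c)%N ->
  #|[set g : {ffun V -> A} | g @: e == g @: (x |: (y |: S))]|%:R
    <= (q * hit1 q c + q * (q - 1) * hit2 q c + 2) / q ^+ 2 * T.
Proof.
move=> xy xS yS xe ye Sc.
rewrite card_set_sum -natr_sum.
have q2 : 0 < q ^+ 2 by rewrite exprn_gt0.
rewrite -(ler_pM2l q2) -natrX -natrM.
under eq_bigr do rewrite !imsetU1.
rewrite (sum_resample2 _ _ x y (fun a b g => nat_of_bool (g @: e == a |: (b |: g @: S)))) //; last 2 first.
- by move=> a b g a'; rewrite !update_notin_imset.
- by move=> a b g a'; rewrite !update_notin_imset.
apply: (le_trans (y := \sum_(g : {ffun V -> A}) ((#|g @: S| ^ 2)%:R + 2))).
  rewrite natr_sum; apply: ler_sum => g _.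
  by rewrite -[X in _ + X]/(2%:R) -natrD ler_nat card_completing_pairs.
rewrite big_split /= sumr_const -[X in _ + X]mulr_natr -/T natrX -/q.
have -> : q ^+ 2 * ((q * hit1 q c + q * (q - 1) * hit2 q c + 2) / q ^+ 2 * T) =
  (q * hit1 q c + q * (q - 1) * hit2 q c) * T + 2 * T by field.
by rewrite lerD2r sum_pairs_hit_le.
Qed.

End BlockCollisions.

(** * Swap tests and pair counts *)

Section SwapTests.
Variables (R : realFieldType) (V : finType) (W : {set V}).
Implicit Types (C : {set V}) (h : {ffun V -> bool}).

Definition swap_test h : {set V} := W :|: [set v | h v].

(** With probability [2 ^- #|C :\: W|] the test contains [C]. Independently, [h y] is a fair coin,
    which disagrees with the membership of [x] half of the time, whether or not [x] lies in [W]. *)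
Lemma swap_test_collision_notin x y C : x != y -> y \notin C -> y \notin W ->
  #|[set h : {ffun V -> bool} |
      (x |: C \subset swap_test h) == (y |: C \subset swap_test h)]|%:R
    <= (1 - 2 ^- #|C :\: W|.+1) * #|{ffun V -> bool}|%:R :> R.
Proof.
move=> xy yC yW; set S := C :\: W.
have okC h : (C \subset swap_test h) = [disjoint h @: S & [set false]].
  rewrite disjoint_sym disjoints1; apply/subsetP/negP => [sub /imsetP[v]|no v vC].
    by rewrite inE => /andP[vW /sub]; rewrite !inE (negPf vW) /= => ->.
  rewrite !inE; have [//|vW /=] := boolP (v \in W); apply: contraT => /negbTE hv.
  by case: no; apply/imsetP; exists v; rewrite // inE vW.
rewrite card_set_sum.
rewrite (eq_bigr (fun h : {ffun V -> bool} => 1 -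
  ([disjoint h @: S & [set false]] && ((x \in swap_test h) != h y))%:R)) => [|h _]; last first.
  rewrite !subUset !sub1set okC.
  have -> : (y \in swap_test h) = h y by rewrite !inE (negPf yW).
  by case: [disjoint _ & _]; case: (x \in _); case: (h y) => /=; rewrite ?subr0 ?subrr.
rewrite sumrB sumr_const mulrBl mul1r lerB // -[leRHS]natr_sum.
have two_gt0 : 0 < #|{: bool}|%:R :> R by rewrite card_bool.
rewrite -(ler_pM2l two_gt0) -natrM.
rewrite (sum_resample _ _ y (fun b h => nat_of_bool
  ([disjoint h @: S & [set false]] && ((x \in swap_test h) != b)))); last first.
  move=> b h c; rewrite update_notin_imset ?inE ?(negPf yC) ?andbF //.
  by rewrite ffunE (negPf xy).
rewrite natr_sum (eq_bigr (fun h : {ffun V -> bool} => [disjoint h @: S & [set false]]%:R)).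
  rewrite sum_avoiding ?card_bool // cards1 exprS invfM.
  have -> : (1 - 1%:R / 2%:R) = 2^-1 :> R by lra.
  by rewrite exprVn; set t := (2 ^+ _)^-1; set T := #|_|%:R; lra.
move=> h _; rewrite big_bool /=; case: [disjoint _ & _] => //=.
by case: (x \in _).
Qed.

Lemma swap_test_collision x y C : x != y -> x \notin C -> y \notin C ->
  ~~ ((x \in W) && (y \in W)) ->
  #|[set h : {ffun V -> bool} |
      (x |: C \subset swap_test h) == (y |: C \subset swap_test h)]|%:R
    <= (1 - 2 ^- #|C :\: W|.+1) * #|{ffun V -> bool}|%:R :> R.
Proof.
move=> xy xC yC; rewrite negb_and => /orP[xW|yW]; last exact: swap_test_collision_notin.
rewrite (eq_card (B := [set h : {ffun V -> bool} |
      (y |: C \subset swap_test h) == (x |: C \subset swap_test h)])); last first.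
  by move=> h; rewrite !inE eq_sym.
by apply: swap_test_collision_notin; rewrite // eq_sym.
Qed.

End SwapTests.

Section PairCounts.
Variables (R : realFieldType) (V : finType) (E : {set {set V}}) (d : nat).
Hypothesis rankE : forall e, e \in E -> (#|e| <= d)%N.
Let N : R := #|E|%:R.
Implicit Types p : {set V} * {set V}.

Definition degree (v : V) : nat := #|[set e in E | v \in e]|.

Lemma sum_pairs_card_le (P : {set V} -> {set V} -> bool) (b : R) :
  (forall e, e \in E -> #|[set f | P e f]|%:R <= b) ->
  \sum_p ((p.1 \in E) && P p.1 p.2)%:R <= N * b.
Proof.
move=> Pb; rewrite -(pair_bigA _ (fun e f => ((e \in E) && P e f)%:R)) /=.
rewrite (eq_bigr (fun e => if e \in E then #|[set f | P e f]|%:R else 0)) => [|e _]; last first.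
  by case: (e \in E) => /=; rewrite ?card_set_sum // big1.
rewrite -big_mkcond /= mulr_natl -sumr_const; apply: ler_sum => e eE; exact: Pb.
Qed.

Lemma count_pairs : \sum_p ((p.1 \in E) && (p.2 \in E))%:R <= N * N.
Proof.
by apply: (sum_pairs_card_le (fun _ f => f \in E)) => e _; rewrite ler_nat cardsE.
Qed.

Lemma count_deletions :
  \sum_p ((p.2 \in E) && [exists v in p.2, p.1 == p.2 :\ v])%:R <= N * d%:R.
Proof.
rewrite -(pair_bigA _ (fun e f : {set V} => ((f \in E) && [exists v in f, e == f :\ v])%:R)).
rewrite exchange_big pair_bigA /=.
apply: (sum_pairs_card_le (fun f e => [exists v in f, e == f :\ v])) => e eE.
rewrite ler_nat; apply: leq_trans (rankE _ eE).
apply: leq_trans (leq_imset_card (fun v => e :\ v) e).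
apply: subset_leq_card; apply/subsetP => f; rewrite inE => /exists_inP[v ve /eqP ->].
exact: imset_f.
Qed.

Lemma count_swaps (W : {set V}) :
  \sum_p ((p.1 \in E) && [exists x in p.1, exists y in W, p.2 == y |: (p.1 :\ x)])%:R
    <= N * (d%:R * #|W|%:R).
Proof.
apply: (sum_pairs_card_le (fun e f => [exists x in e, exists y in W, f == y |: (e :\ x)])) => e eE.
rewrite -natrM ler_nat; apply: (@leq_trans (#|e| * #|W|)); last by rewrite leq_mul2r rankE ?orbT.
rewrite -cardsX; apply: leq_trans (leq_imset_card (fun z => z.2 |: (e :\ z.1)) _).
apply: subset_leq_card; apply/subsetP => f; rewrite inE.
move=> /exists_inP[x xe /exists_inP[y yW /eqP ->]].
by apply/imsetP; exists (x, y); rewrite // inE xe.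
Qed.

(** Given [e], the edge [f] passes through one of the at most [d] vertices of [e] outside [W], each
    of which lies on at most [D] edges. *)
Lemma count_light_intersections (D : R) (W : {set V}) :
  (forall v, v \notin W -> (degree v)%:R <= D) -> 0 <= D ->
  \sum_p ((p.1 \in E) && ((p.2 \in E) && [exists v in p.1 :&: p.2, v \notin W]))%:R
    <= N * (d%:R * D).
Proof.
move=> degD D_ge0.
apply: (sum_pairs_card_le (fun e f => (f \in E) && [exists v in e :&: f, v \notin W])) => e eE.
apply: (le_trans (y := \sum_(v in e :\: W) (degree v)%:R)).
  rewrite -natr_sum ler_nat.
  apply: (@leq_trans #|\bigcup_(v in e :\: W) [set f in E | v \in f]|).
    apply: subset_leq_card; apply/subsetP => f; rewrite inE => /andP[fE].
    move=> /exists_inP[v]; rewrite inE => /andP[ve vf] vW.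
    by apply/bigcupP; exists v; rewrite !inE ?ve ?vW ?fE.
  rewrite /degree; elim/big_rec2: _ => [|v n B _ IH]; first by rewrite cards0.
  by apply: leq_trans (leq_card_setU _ _) _; rewrite leq_add2l.
apply: (le_trans (y := \sum_(v in e :\: W) D)).
  by apply: ler_sum => v; rewrite inE => /andP[vW _]; apply: degD.
rewrite sumr_const -[leLHS]mulr_natl ler_wpM2r // ler_nat.
by apply: leq_trans (rankE _ eE); apply: subset_leq_card; apply: subsetDl.
Qed.

(** Markov's inequality for the degrees, whose sum is the sum of the edge sizes. *)
Lemma card_heavy_le (D : R) :
  #|[set v | D < (degree v)%:R]|%:R * D <= d%:R * N.
Proof.
set W := finset _; apply: (le_trans (y := \sum_(v in W) (degree v)%:R)).
  by rewrite mulr_natl -sumr_const; apply: ler_sum => v; rewrite inE => /ltW.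
rewrite -natr_sum -natrM ler_nat.
apply: (@leq_trans (\sum_v degree v)).
  by rewrite [leqRHS](bigID (mem W)) leq_addr.
have -> : (\sum_v degree v = \sum_(e in E) #|e|)%N.
  rewrite /degree; under eq_bigr do rewrite -sum1_card.
  rewrite (eq_bigr (fun v => \sum_(e in E) (v \in e))%N) => [|v _].
    by rewrite exchange_big; apply: eq_bigr => e _; rewrite sum_nat_indicator.
  by rewrite big_mkcond [RHS]big_mkcond; apply: eq_bigr => e _; rewrite inE; do 2!case: (_ \in _).
by rewrite mulnC -sum_nat_const; apply: leq_sum => e eE; apply: rankE.
Qed.

End PairCounts.

(** * The union bound *)

Section Blocks.
Variables (V A : finType).

Definition block_tests (g : {ffun V -> A}) : seq {set V} :=
  [seq [set v | g v != a] | a <- enum A].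

Lemma eq_outcome_block (g : {ffun V -> A}) (e f : {set V}) :
  (forall T, T \in block_tests g -> test_outcome T e = test_outcome T f) ->
  g @: e = g @: f.
Proof.
move=> eq_out; apply/setP => a.
have out (h : {set V}) : test_outcome [set v | g v != a] h = (a \notin g @: h).
  apply/subsetP/negP => [sub /imsetP[v /sub]|no v vh].
    by rewrite inE => /eqP ne eqa; apply: ne.
  by rewrite inE; apply/eqP => gva; apply: no; rewrite -gva imset_f.
apply: negb_inj; rewrite -!out; apply: eq_out.
by apply/mapP; exists a; rewrite // mem_enum.
Qed.

End Blocks.

Lemma identifies_card_le (V : finType) (E : {set {set V}}) (tests : seq {set V}) :
  (forall e f, e \in E -> f \in E -> (#|e| <= #|f|)%N ->
    (forall T, T \in tests -> test_outcome T e = test_outcome T f) -> e = f) ->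
  identifies E tests.
Proof.
move=> h e f eE fE eq_out; have [ef|/ltnW fe] := leqP #|e| #|f|; first exact: h.
by apply/esym; apply: h => // T /eq_out.
Qed.

(** From [#|e| <= #|f|] follows [#|e :\: f| <= #|f :\: e|]; the former is positive and the latter at
    most one, so both equal one. *)
Lemma swap_decomposition (V : finType) (e f : {set V}) :
  (#|e| <= #|f|)%N -> (#|f :\: e| < 2)%N -> ~~ (e \subset f) ->
  exists x y, [/\ x != y, x \notin e :&: f, y \notin e :&: f,
    e = x |: (e :&: f) & f = y |: (e :&: f)].
Proof.
move=> ef fe nef.
have ne0 : (0 < #|e :\: f|)%N by rewrite card_gt0 setD_eq0.
have := cardsID f e; have := cardsID e f; rewrite [f :&: e]setIC => hf he.
have /cards1P[x ex] : #|e :\: f| == 1%N by apply/eqP; lia.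
have /cards1P[y fy] : #|f :\: e| == 1%N by apply/eqP; lia.
have := set11 x; rewrite -ex inE => /andP[xf xe].
have := set11 y; rewrite -fy inE => /andP[ye yf].
exists x, y; split; rewrite ?inE ?xe ?yf ?(negPf xf) ?(negPf ye) ?andbF //.
- by apply: contraNneq xf => ->.
- by rewrite -ex setUC setID.
- by rewrite -fy setIC setUC setID.
Qed.

Lemma card_setD2 (V : finType) (f : {set V}) x y n :
  x \in f -> y \in f -> x != y -> (#|f| <= n)%N -> (#|f :\ x :\ y| <= n.-2)%N.
Proof.
move=> xf yf xy; rewrite (cardsD1 x f) xf (cardsD1 y (f :\ x)) !inE eq_sym xy yf /=.
by case: n => [|[|n]] //=; rewrite !add1n !ltnS.
Qed.

Lemma leq_pred_of_ltn a b n : (a < b)%N -> (b <= n)%N -> (a <= n.-1)%N.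
Proof. by case: n => [|n] ab bn; [case: b ab bn|rewrite -ltnS (leq_trans ab)]. Qed.

Lemma setD1_of_card (V : finType) (e f : {set V}) :
  e \subset f -> e != f -> (#|f :\: e| < 2)%N -> exists2 v, v \in f & e = f :\ v.
Proof.
move=> sub neq small; have /subsetPn[v vf ve] : ~~ (f \subset e).
  by move: neq; rewrite eqEsubset sub.
exists v => //; have fe : [set v] = f :\: e.
  by apply/eqP; rewrite eqEcard sub1set inE ve vf cards1.
by rewrite fe setDDr setDv set0U; apply/esym/setIidPr.
Qed.

Section UnionBound.
Variables (R : realFieldType) (V : finType) (E : {set {set V}}) (d m k k2 : nat) (D : R).
Hypothesis rankE : forall e, e \in E -> (#|e| <= d)%N.
Hypotheses (m_gt1 : (1 < m)%N) (D_gt0 : 0 < D).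
Let N : R := #|E|%:R.
Let q : R := m%:R.
Let th : R := hit1 q d.-1.
Let s : R := q^-1 + (1 - q^-1) * hit2 q d.-1.
Hypothesis big_le :
  (q * hit1 q d.-2 + q * (q - 1) * hit2 q d.-2 + 2) / q ^+ 2 <= th ^+ 2.

Let W : {set V} := [set v | D < (degree V E v)%:R].
Implicit Types p : {set V} * {set V}.
Let Q p := [&& p.1 \in E, p.2 \in E, (#|p.1| <= #|p.2|)%N & p.1 != p.2].
Let big p := (1 < #|p.2 :\: p.1|)%N.
Let swap p := ~~ big p && ~~ (p.1 \subset p.2).
Let inW p := (p.1 :\: p.2 \subset W) && (p.2 :\: p.1 \subset W).
Let interW p := p.1 :&: p.2 \subset W.

(** [a p] bounds the probability that one random block fails to separate [p]. Pairs outside [Q] get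
    weight zero in the union bound, so the trivial value 1 serves for them. *)
Let a p : R := if Q p then (if big p then th ^+ 2 else if p.1 \subset p.2 then th else s) else 1.
(** The analogue of [a] for one swap test: with [C = p.1 :&: p.2], the value [2^-1] is for [C :\: W]
    empty, and [1 - 2 ^- d] is the worst case. *)
Let b p : R := if Q p && swap p then
  (if inW p then 1 else if interW p then 2^-1 else 1 - 2 ^- d) else 1.
Let Coll1 p := [set g : {ffun V -> 'I_m} | g @: p.1 == g @: p.2].
Let Coll2 p := [set h : {ffun V -> bool} |
  (p.1 \subset swap_test V W h) == (p.2 \subset swap_test V W h)].

Let q_ge2 : 2 <= q. Proof. by rewrite ler_nat. Qed.
Let q_ge1 : 1 <= q. Proof. by apply: le_trans q_ge2; rewrite ler1n. Qed.
Let hit2_ge0 c : 0 <= hit2 q c.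
Proof.
apply: le_trans (hit2_mono R q 0 c q_ge2 (leq0n c)).
by rewrite /hit2 !expr0; lra.
Qed.
Let th_ge0 : 0 <= th.
Proof. by apply: le_trans (hit1_mono R q 0 _ q_ge1 (leq0n _)); rewrite /hit1 expr0 subrr. Qed.
Let qi_ge0 : 0 <= q^-1. Proof. by rewrite invr_ge0 (le_trans ler01). Qed.
Let qi_le1 : q^-1 <= 1. Proof. by rewrite invf_le1 // (lt_le_trans ltr01). Qed.
Let s_ge0 : 0 <= s.
Proof. by rewrite addr_ge0 // mulr_ge0 ?subr_ge0. Qed.
Let pow2_le1 : 2 ^- d <= 1 :> R.
Proof. by rewrite invf_le1 ?exprn_ege1 ?exprn_gt0 // ler1n. Qed.

Let a_ge0 p : 0 <= a p.
Proof. by rewrite /a; do ?case: ifP => _; rewrite ?exprn_ge0 ?ler01. Qed.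
Let b_ge0 p : 0 <= b p.
Proof. by rewrite /b; do ?case: ifP => _; rewrite ?ler01 ?invr_ge0 ?ler0n ?subr_ge0. Qed.

Let card_Coll1 p : #|Coll1 p|%:R <= a p * #|{ffun V -> 'I_m}|%:R.
Proof.
case: p => e f; rewrite /a; case: ifPn => [|_]; last by rewrite mul1r ler_nat max_card.
rewrite /Q /= => /and4P[eE fE ef neq].
have m_gt1' : (1 < #|'I_m|)%N by rewrite card_ord.
case: ifPn => [|small].
  rewrite /big /= => /card_gt1P[x [y [xf yf xy]]].
  move: xf yf; rewrite !inE => /andP[xe xf] /andP[ye yf].
  have xS : x \notin f :\ x :\ y by rewrite !inE eqxx andbF.
  have yS : y \notin f :\ x :\ y by rewrite !inE eqxx.
  have fE' : f = x |: (y |: (f :\ x :\ y)) by rewrite setD1K ?setD1K // !inE eq_sym xy.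
  rewrite /Coll1 /= [in X in #|X|]fE'.
  apply: (le_trans (card_big_collision R V _ m_gt1' x y _ _ d.-2 _ _ _ _ _ _)) => //.
    exact: card_setD2 (rankE _ fE).
  by rewrite card_ord ler_wpM2r // ler0n.
case: ifPn => [sub|nsub].
  have /subsetPn[v vf ve] : ~~ (f \subset e).
    by move: neq; rewrite eqEsubset sub.
  apply: (le_trans (y := #|[set g : {ffun V -> 'I_m} | g v \in g @: e]|%:R)).
    rewrite ler_nat; apply: subset_leq_card; apply/subsetP => g; rewrite !inE /= => /eqP ->.
    exact: imset_f.
  have ed : (#|e| <= d.-1)%N.
    by apply: leq_pred_of_ltn (rankE _ fE); rewrite proper_card // properEneq neq.
  by have := card_hit_vertex R V _ m_gt1' v e _ ve ed; rewrite card_ord.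
have [|x [y [xy xI yI eI fI]]] := swap_decomposition V e f ef _ nsub.
  by move: small; rewrite /big -leqNgt.
have -> : Coll1 (e, f) = [set g : {ffun V -> 'I_m} | g @: (x |: e :&: f) == g @: (y |: e :&: f)].
  by rewrite -eI -fI.
have eC : (#|e :&: f| <= d.-1)%N.
  by apply: leq_pred_of_ltn (rankE _ eE); rewrite [in X in (_ < X)%N]eI cardsU1 xI.
by have := card_swap_collision R V _ m_gt1' x y _ _ xy xI yI eC; rewrite card_ord.
Qed.

Let card_Coll2 p : #|Coll2 p|%:R <= b p * #|{ffun V -> bool}|%:R.
Proof.
case: p => e f; rewrite /b; case: ifPn => [|_]; last by rewrite mul1r ler_nat max_card.
rewrite /Q /swap /inW /interW /= => /andP[/and4P[eE fE ef neq] /andP[small nsub]].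
case: ifPn => [_|ninW]; first by rewrite mul1r ler_nat max_card.
have [|x [y [xy xI yI eI fI]]] := swap_decomposition V e f ef _ nsub.
  by move: small; rewrite /big -leqNgt.
have xyW : ~~ ((x \in W) && (y \in W)).
  apply: contra ninW => /andP[xW yW]; apply/andP; split; apply/subsetP => z.
    move=> /setDP[ze zf]; have /setU1P[-> //|] : z \in x |: e :&: f by rewrite -eI.
    by move=> /setIP[_]; rewrite (negPf zf).
  move=> /setDP[zf ze]; have /setU1P[-> //|] : z \in y |: e :&: f by rewrite -fI.
  by move=> /setIP[]; rewrite (negPf ze).
have -> : Coll2 (e, f) = [set h : {ffun V -> bool} |
    (x |: e :&: f \subset swap_test V W h) == (y |: e :&: f \subset swap_test V W h)].
  by rewrite -eI -fI.
apply: (le_trans (swap_test_collision R V W x y _ xy xI yI xyW)).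
rewrite ler_wpM2r ?ler0n //; case: ifPn => [sub|_].
  by move: sub; rewrite -setD_eq0 => /eqP ->; rewrite cards0 expr1; lra.
(* The intersection has one vertex fewer than [e], so the exponent is at most [#|e| <= d]. *)
rewrite lerB // lef_pV2 ?posrE ?exprn_gt0 // ler_weXn2l ?ler1n //.
apply: leq_trans (rankE _ eE); rewrite [in X in (_ <= X)%N]eI cardsU1 xI ltnS.
by apply: subset_leq_card; apply: subsetDl.
Qed.

(** The terms come, in order, from pairs with two vertices of [p.2] outside [p.1], deletions of one
    vertex, swaps of two heavy vertices (with [#|W| <= d N / D]), swaps whose intersection is heavy,
    and swaps whose intersection has a light vertex. *)
Let sum_bound :
  \sum_p (Q p)%:R * a p ^+ k * b p ^+ k2 <=
    (N * th ^+ k) ^+ 2 + d%:R * N * th ^+ k + d%:R * N * (d%:R * N / D) * s ^+ k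
    + N ^+ 2 * s ^+ k * 2^-1 ^+ k2 + d%:R * N * D * s ^+ k * (1 - 2 ^- d) ^+ k2.
Proof.
pose I1 p := (p.1 \in E) && (p.2 \in E).
pose I2 p := (p.2 \in E) && [exists v in p.2, p.1 == p.2 :\ v].
pose I3 p := (p.1 \in E) && [exists x in p.1, exists y in W, p.2 == y |: (p.1 :\ x)].
pose I5 p := (p.1 \in E) && ((p.2 \in E) && [exists v in p.1 :&: p.2, v \notin W]).
have thk : 0 <= th ^+ k by rewrite exprn_ge0.
have sk : 0 <= s ^+ k by rewrite exprn_ge0.
have hk : 0 <= 2^-1 ^+ k2 :> R by rewrite exprn_ge0 // invr_ge0 ler0n.
have wk : 0 <= (1 - 2 ^- d) ^+ k2 :> R by rewrite exprn_ge0 // subr_ge0.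
apply: (le_trans (y := \sum_p ((I1 p)%:R * (th ^+ k) ^+ 2 + (I2 p)%:R * th ^+ k
   + (I3 p)%:R * s ^+ k + (I1 p)%:R * (s ^+ k * 2^-1 ^+ k2)
   + (I5 p)%:R * (s ^+ k * (1 - 2 ^- d) ^+ k2)))).
  apply: ler_sum => -[e f] _.
  have t1 : 0 <= (I1 (e, f))%:R * (th ^+ k) ^+ 2 by rewrite mulr_ge0 ?ler0n ?exprn_ge0.
  have t2 : 0 <= (I2 (e, f))%:R * th ^+ k by rewrite mulr_ge0 ?ler0n.
  have t3 : 0 <= (I3 (e, f))%:R * s ^+ k by rewrite mulr_ge0 ?ler0n.
  have t4 : 0 <= (I1 (e, f))%:R * (s ^+ k * 2^-1 ^+ k2).
    by rewrite mulr_ge0 ?ler0n // mulr_ge0.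
  have t5 : 0 <= (I5 (e, f))%:R * (s ^+ k * (1 - 2 ^- d) ^+ k2).
    by rewrite mulr_ge0 ?ler0n // mulr_ge0.
  have [Qp|_] := boolP (Q (e, f)); last by rewrite !mul0r !addr_ge0.
  rewrite mul1r /a /b Qp /=; have := Qp; rewrite /Q /= => /and4P[eE fE ef neq].
  have I1p : I1 (e, f) by rewrite /I1 /= eE fE.
  rewrite /swap; have [bigp|small] /= := boolP (big (e, f)).
    rewrite expr1n mulr1 exprAC; move: t2 t3 t4 t5; rewrite I1p !mul1r; lra.
  have [sub|nsub] /= := boolP (e \subset f).
    rewrite expr1n mulr1; have I2p : I2 (e, f).
      have [|v vf ev] := setD1_of_card V e f sub neq; first by rewrite ltnNge.
      by rewrite /I2 /= fE /=; apply/exists_inP; exists v; rewrite // ev.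
    move: t1 t3 t4 t5; rewrite I2p !mul1r; lra.
  have [|x [y [xy xI yI eI fI]]] := swap_decomposition V e f ef _ nsub.
    by move: small; rewrite /big -leqNgt.
  have xe : x \in e by rewrite eI setU11.
  have yf : y \in f by rewrite fI setU11.
  have [/andP[/= eW fW]|_] := boolP (inW (e, f)).
    rewrite expr1n mulr1; have I3p : I3 (e, f).
      rewrite /I3 /= eE /=; apply/exists_inP; exists x => //; apply/exists_inP; exists y.
        apply: (subsetP fW); rewrite inE yf andbT; apply: contra yI => ye; by rewrite inE ye.
      by rewrite [in X in _ |: (X :\ _)]eI setU1K // [in X in X == _]fI.
    move: t1 t2 t4 t5; rewrite I3p !mul1r; lra.
  have [_|nW] := boolP (interW (e, f)).
    move: t1 t2 t3 t5; rewrite I1p !mul1r; lra.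
  have I5p : I5 (e, f).
    rewrite /I5 /= eE fE /=; move: nW; rewrite /interW /= => /subsetPn[v vI vW].
    by apply/exists_inP; exists v.
  move: t1 t2 t3 t4; rewrite I5p !mul1r; lra.
rewrite !big_split /= -!mulr_suml.
have c1 := count_pairs R V E; have c2 := count_deletions R V E d rankE.
have c3 := count_swaps R V E d rankE W.
have degW v : v \notin W -> (degree V E v)%:R <= D by rewrite inE -leNgt.
have c5 := count_light_intersections R V E d rankE D W degW (ltW D_gt0).
have N_ge0 : 0 <= N by rewrite ler0n.
have cW : #|W|%:R <= d%:R * N / D by rewrite ler_pdivlMr // card_heavy_le.
have c3' : N * (d%:R * #|W|%:R) <= d%:R * N * (d%:R * N / D).
  by rewrite mulrA [N * _]mulrC ler_wpM2l // mulr_ge0 ?ler0n.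
have h1 := ler_wpM2r (exprn_ge0 2 thk) c1; have h2 := ler_wpM2r thk c2.
have h3 := ler_wpM2r sk (le_trans c3 c3'); have h4 := ler_wpM2r (mulr_ge0 sk hk) c1.
have h5 := ler_wpM2r (mulr_ge0 sk wk) c5.
apply: (le_trans (lerD (lerD (lerD (lerD h1 h2) h3) h4) h5)).
rewrite le_eqVlt; apply/orP; left; apply/eqP; rewrite -/N; ring.
Qed.

(** The derandomized choice is made twice: for the blocks with weights [b p ^+ k2], then for the
    swap tests with weights supported on the pairs that the blocks leave unseparated. *)
Lemma exists_tests_of_small_sum :
  (N * th ^+ k) ^+ 2 + d%:R * N * th ^+ k + d%:R * N * (d%:R * N / D) * s ^+ k
    + N ^+ 2 * s ^+ k * 2^-1 ^+ k2 + d%:R * N * D * s ^+ k * (1 - 2 ^- d) ^+ k2 < 1 ->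
  exists tests : seq {set V}, identifies E tests /\ size tests = (m * k + k2)%N.
Proof.
move=> small; have := le_lt_trans sum_bound small => {small} small.
have T1 : (0 < #|{ffun V -> 'I_m}|)%N by rewrite card_ffun card_ord expn_gt0 (ltnW m_gt1).
have T2 : (0 < #|{ffun V -> bool}|)%N by rewrite card_ffun card_bool expn_gt0.
have w1 p : 0 <= (Q p)%:R * b p ^+ k2 by rewrite mulr_ge0 ?ler0n ?exprn_ge0.
have [s1 [sz1 le1]] := exists_seq_below_average R _ _ Coll1 a T1 a_ge0 card_Coll1 k _ w1.
have w2 p : 0 <= (Q p)%:R * (all (fun g => g \in Coll1 p) s1)%:R :> R by rewrite mulr_ge0 ?ler0n.
have [s2 [sz2 le2]] := exists_seq_below_average R _ _ Coll2 b T2 b_ge0 card_Coll2 k2 _ w2.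
have {le1 le2 small} lt1 : \sum_p (Q p)%:R * (all (fun g => g \in Coll1 p) s1)%:R *
    (all (fun h => h \in Coll2 p) s2)%:R < 1 :> R.
  apply: (le_lt_trans le2); apply: le_lt_trans small.
  rewrite (eq_bigr (fun p => (Q p)%:R * b p ^+ k2 * (all (fun g => g \in Coll1 p) s1)%:R)) => [|p _].
    apply: (le_trans le1); rewrite le_eqVlt; apply/orP; left; apply/eqP.
    by apply: eq_bigr => p _; rewrite mulrAC.
  by rewrite mulrAC.
exists (flatten [seq block_tests V _ g | g <- s1] ++ [seq swap_test V W h | h <- s2]).
split; last first.
  rewrite size_cat size_map sz2; congr addn; rewrite mulnC -sz1.
  elim: s1 {sz1 lt1 w2} => //= g s1 IH.
  by rewrite size_cat IH size_map -cardE card_ord mulSn.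
apply: identifies_card_le => e f eE fE ef eq_out; apply/eqP; apply: contraT => neq.
(* A single unseparated pair would contribute 1 to a sum below 1. *)
move: lt1; rewrite ltNge => /negP[]; rewrite (bigD1 (e, f)) //= {1}/Q /= eE fE ef neq /=.
have -> : all (fun g => g \in Coll1 (e, f)) s1.
  apply/allP => g gs; rewrite inE /=; apply/eqP; apply: eq_outcome_block => T Tg.
  by apply: eq_out; rewrite mem_cat; apply/orP; left; apply/flattenP; exists (block_tests V _ g); rewrite // map_f.
have -> : all (fun h => h \in Coll2 (e, f)) s2.
  apply/allP => h hs; rewrite inE /=; apply/eqP; apply: eq_out.
  by rewrite mem_cat map_f ?orbT.
rewrite !mul1r lerDl; apply: sumr_ge0 => p _.
by rewrite !mulr_ge0 ?ler0n.
Qed.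

End UnionBound.

(** * Ranks one and two *)

Section GraphCodes.
Local Open Scope nat_scope.
Variables (V I A : finType).
Local Notation K := {ffun I -> A}.
Implicit Types (f : {ffun V -> K}) (e : {set V}).

Definition coordinate f (i : I) : {ffun V -> A} := [ffun v => f v i].

Definition same_code f e e' := [forall i, coordinate f i @: e == coordinate f i @: e'].

Lemma coordinate_update f v c i u :
  coordinate (update V K f v c) i u = if u == v then c i else coordinate f i u.
Proof. by rewrite !ffunE; case: eqP. Qed.

Lemma coordinate_update_in f v c i e : v \in e ->
  coordinate (update V K f v c) i @: e = c i |: coordinate f i @: (e :\ v).
Proof.
move=> ve; rewrite -[in LHS](setD1K ve) imsetU1 coordinate_update eqxx; congr (_ |: _).
apply: eq_in_imset => u; rewrite coordinate_update !inE.
by case: eqP.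
Qed.

Lemma coordinate_update_notin f v c i e : v \notin e ->
  coordinate (update V K f v c) i @: e = coordinate f i @: e.
Proof.
move=> ve; apply: eq_in_imset => u ue; rewrite coordinate_update.
by case: eqP => // uv; rewrite -uv ue in ve.
Qed.

Lemma setU1_set1_inj (a b c : A) : a |: [set c] = b |: [set c] -> a = b.
Proof.
move=> eqs; have := setU11 a [set c]; rewrite eqs !inE => /orP[/eqP //|/eqP ac].
have := setU11 b [set c]; rewrite -eqs !inE => /orP[/eqP //|/eqP bc].
by rewrite ac bc.
Qed.

Lemma card2_setD1 e v : #|e| = 2 -> v \in e -> exists w, e :\ v = [set w].
Proof.
by move=> e2 ve; apply/cards1P; have := cardsD1 v e; rewrite e2 ve add1n => -[<-].
Qed.

Lemma sum_degree_in (E : {set {set V}}) (U : {set V}) : (forall e, e \in E -> #|e| = 2) ->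
  \sum_(v in U) #|[set e in E | (v \in e) && (e \subset U)]| <= 2 * #|E|.
Proof.
move=> E2.
rewrite (eq_bigr (fun v => \sum_(e in E) ((v \in e) && (e \subset U) : nat))) => [|v _].
  rewrite exchange_big /= mulnC -sum_nat_const; apply: leq_sum => e eE.
  rewrite -(E2 e eE) -[leqRHS]sum_nat_indicator [leqRHS](bigID (mem U)) /=.
  by apply: leq_trans (leq_addr _ _); apply: leq_sum => v _; case: (v \in e); case: (_ \subset _).
rewrite -sum1_card big_mkcond [RHS]big_mkcond; apply: eq_bigr => e _; rewrite inE.
by do 3!case: (_ \in _) => //=; case: (_ \subset _).
Qed.

(* A vertex of degree [k] has [k] neighbours, so minimal degree [k] forces at least [k * k]
   incidences, while there are at most [2 * #|E|]. *)
Lemma exists_small_degree (E : {set {set V}}) (U : {set V}) : (forall e, e \in E -> #|e| = 2) ->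
  U != set0 -> exists2 v, v \in U & #|[set e in E | (v \in e) && (e \subset U)]| ^ 2 <= 2 * #|E|.
Proof.
move=> E2 /set0Pn[v0 v0U].
pose deg v := #|[set e in E | (v \in e) && (e \subset U)]|.
case: (arg_minnP deg v0U) => v vU vmin; exists v => //.
apply: leq_trans (sum_degree_in E U E2).
apply: (@leq_trans (\sum_(u in U) deg v)); last by apply: leq_sum => u uU; apply: vmin.
rewrite sum_nat_const -mulnn leq_mul2r -/(deg v); apply/orP; right.
apply: leq_trans (subset_leq_card (subD1set U v)).
apply: leq_trans (leq_imset_card (fun u => [set v; u]) _).
apply: subset_leq_card; apply/subsetP => e; rewrite inE => /and3P[eE ve eU].
have [u eu] := card2_setD1 e v (E2 e eE) ve.
apply/imsetP; exists u; last by rewrite -(setD1K ve) eu.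
have : u \in e :\ v by rewrite eu set11.
by rewrite !inE => /andP[-> /(subsetP eU)].
Qed.

(** Vertices are inserted in reverse order of removal by minimal degree. The code of [v] must avoid
    the codes already used and, for each edge [e] through [v] inside [U] and each edge [e'], the at
    most one code making them collide. Two edges through [v] are separated by injectivity alone. *)
Lemma exists_graph_code (E : {set {set V}}) (X : {set V}) :
  (forall e, e \in E -> #|e| = 2) ->
  (forall k, k ^ 2 <= 2 * #|E| -> k * #|E| + #|X| < #|K|) ->
  exists f : {ffun V -> K}, {in X &, injective f} /\
    {in E &, forall e e', e \subset X -> e' \subset X -> same_code f e e' -> e = e'}.
Proof.
move=> E2 hK; have [c0] : exists c0 : K, true.
  have : 0 < #|K| by apply: leq_ltn_trans (hK 0 _).
  by move/card_gt0P => [c _]; exists c.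
move=> _.
suff H n (U : {set V}) : #|U| = n -> U \subset X ->
    exists f : {ffun V -> K}, {in U &, injective f} /\
    {in E &, forall e e', e \subset U -> e' \subset U -> same_code f e e' -> e = e'}.
  exact: (H _ X).
elim: n U => [|n IH] U.
  move=> /eqP; rewrite cards_eq0 => /eqP -> _; exists [ffun=> c0].
  split=> [u v|e e' eE _]; first by rewrite inE.
  by rewrite subset0 => /eqP e0; have := E2 e eE; rewrite e0 cards0.
move=> cardU UX; have U0 : U != set0 by rewrite -cards_eq0 cardU.
have [v vU degv] := exists_small_degree E U E2 U0.
have cardU' : #|U :\ v| = n by have := cardsD1 v U; rewrite vU cardU => -[].
have [|f [finj fsep]] := IH _ cardU'.
  exact: subset_trans (subD1set U v) UX.
set Ev := [set e in E | (v \in e) && (e \subset U)] in degv.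
pose bad (p : {set V} * {set V}) := [set c : K |
  [forall i, c i |: coordinate f i @: (p.1 :\ v) == coordinate f i @: p.2]].
have [c cB] : exists c, c \notin f @: (U :\ v) :|: \bigcup_(p in setX Ev E) bad p.
  have : #|f @: (U :\ v) :|: \bigcup_(p in setX Ev E) bad p| < #|K|.
    apply: leq_ltn_trans (hK _ degv).
    apply: leq_trans (leq_card_setU _ _) _; rewrite addnC; apply: leq_add; last first.
      apply: leq_trans (leq_imset_card _ _) _; apply: subset_leq_card.
      exact: subset_trans (subD1set U v) UX.
    rewrite -cardsX -[leqRHS]sum1_card.
    elim/big_rec2: _ => [|p m B pS IHB]; first by rewrite cards0.
    apply: leq_trans (leq_card_setU _ _) _; apply: leq_add => //.
    move: pS; case: p => e e'; rewrite !inE /= => /andP[/and3P[eE ve eU] e'E].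
    have [w ew] := card2_setD1 e v (E2 e eE) ve.
    (* Two codes bad for the same pair agree in every coordinate, since the set formed by a letter
       and a known letter determines the former. *)
    rewrite leqNgt; apply/negP => /card_gt1P[c [c' [cb cb' /eqP]]]; apply.
    move: cb cb'; rewrite !inE /= ew => /forallP cb /forallP cb'.
    apply/ffunP => i; apply: (setU1_set1_inj _ _ (coordinate f i w)).
    by have /eqP := cb i; have /eqP := cb' i; rewrite imset_set1 => -> ->.
  rewrite -cardsT; set B := _ :|: _ => ltB.
  have /subsetPn[c _ cB] : ~~ ([set: K] \subset B).
    by apply: contraL ltB => /subset_leq_card; rewrite -leqNgt.
  by exists c.
move: cB; rewrite inE negb_or => /andP[cU cbad].
exists (update V K f v c); split.
  have fU u : u \in U -> u != v -> update V K f v c u = f u.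
    by move=> _ /negPf uv; rewrite ffunE uv.
  have fv : update V K f v c v = c by rewrite ffunE eqxx.
  have cne u : u \in U -> u != v -> f u <> c.
    by move=> uU uv fuc; move/negP: cU; apply; rewrite -fuc imset_f // !inE uv.
  move=> x y xU yU; have [->|xv] := eqVneq x v; have [->|yv] := eqVneq y v => //.
  - by rewrite fv fU // => /esym /(cne _ yU yv).
  - by rewrite fv fU // => /(cne _ xU xv).
  - by rewrite !fU //; apply: finj; rewrite !inE ?xv ?yv.
have inU' e : v \notin e -> e \subset U -> e \subset U :\ v.
  by move=> ve eU; rewrite subsetD1 eU.
have key e e' : e \in E -> e' \in E -> v \in e -> v \notin e' -> e \subset U ->
    same_code (update V K f v c) e e' -> False.
  move=> eE e'E ve ve' eU /forallP same; move/negP: cbad; apply.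
  apply/bigcupP; exists (e, e'); first by rewrite !inE /= eE ve eU.
  rewrite inE /=; apply/forallP => i; have := same i.
  by rewrite coordinate_update_in // coordinate_update_notin.
move=> e e' eE e'E eU e'U same.
have sym : same_code (update V K f v c) e' e.
  by apply/forallP => i; rewrite eq_sym; exact: (forallP same i).
have [ve|ve] := boolP (v \in e); have [ve'|ve'] := boolP (v \in e').
- have [w ew] := card2_setD1 e v (E2 e eE) ve.
  have [w' ew'] := card2_setD1 e' v (E2 e' e'E) ve'.
  have wU : w \in U :\ v by apply: (subsetP (setSD _ eU)); rewrite ew set11.
  have wU' : w' \in U :\ v by apply: (subsetP (setSD _ e'U)); rewrite ew' set11.
  rewrite -(setD1K ve) -(setD1K ve') ew ew'; congr (_ |: [set _]).
  apply: finj => //; apply/ffunP => i; have /eqP := forallP same i.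
  rewrite !coordinate_update_in // ew ew' !imset_set1 !(setUC [set c i]) => /setU1_set1_inj.
  by rewrite !ffunE.
- by case: (key e e').
- by case: (key e' e).
- apply: fsep => //; rewrite ?inU' //; apply/forallP => i; have := forallP same i.
  by rewrite !coordinate_update_notin.
Qed.

End GraphCodes.

Section SmallRankTests.
Local Open Scope nat_scope.

(** Each of the [k.+1] ternary coordinates costs one block of three tests. Codes are built for the
    edges of size two; injectivity on all covered vertices handles the smaller edges. *)
Lemma graph_tests (V : finType) (E : {set {set V}}) (k : nat) :
  (forall e, e \in E -> #|e| <= 2) ->
  (forall j, j ^ 2 <= 2 * #|E| -> j * #|E| + 2 * #|E| < 3 ^ k.+1) ->
  exists tests : seq {set V}, identifies E tests /\ size tests = 3 * k.+1.
Proof.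
move=> rankE hk.
pose E2 := [set e in E | #|e| == 2]; pose X := \bigcup_(e in E) e.
have E2E : #|E2| <= #|E| by apply: subset_leq_card; apply/subsetP => e; rewrite inE => /andP[].
have subX e : e \in E -> e \subset X by move=> eE; apply: bigcup_sup.
have cardX : #|X| <= 2 * #|E|.
  rewrite mulnC -sum_nat_const /X; apply: (@leq_trans (\sum_(e in E) #|e|)); last exact: leq_sum.
  elim/big_rec2: _ => [|e m B eE IH]; first by rewrite cards0.
  by apply: leq_trans (leq_card_setU _ _) _; rewrite leq_add2l.
have [|j hj|f [finj fsep]] := exists_graph_code V 'I_k.+1 'I_3 E2 X.
- by move=> e; rewrite inE => /andP[_ /eqP].
- rewrite card_ffun !card_ord; apply: leq_ltn_trans (hk j _).
    by rewrite leq_add // leq_mul2l E2E orbT.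
  by apply: leq_trans hj _; rewrite leq_mul2l E2E orbT.
pose tests := flatten [seq block_tests V _ (coordinate V _ _ f i) | i <- enum 'I_k.+1].
exists tests; split; last first.
  rewrite /tests -[in RHS](size_enum_ord k.+1); elim: (enum _) => [|i s IH] //=.
  by rewrite size_cat IH size_map size_enum_ord mulnS.
apply: identifies_card_le => e e' eE e'E ee' eq_out.
have same i : coordinate V _ _ f i @: e = coordinate V _ _ f i @: e'.
  apply: eq_outcome_block => T Tg; apply: eq_out; apply/flattenP.
  exists (block_tests V _ (coordinate V _ _ f i)) => //.
  by apply/mapP; exists i; rewrite ?mem_enum.
(* The empty edge has empty image in coordinate [ord0], which exists because the length is
   [k.+1]. *)
have [e0|[a ae]] := set_0Vmem e.
  by apply/esym/eqP; rewrite e0 -(imset_eq0 (coordinate V _ _ f ord0)) -same e0 imset0.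
have [e2|e2] := eqVneq #|e| 2.
  have e'2 : #|e'| == 2 by rewrite eqn_leq rankE //= -e2.
  apply: fsep; rewrite ?inE ?eE ?e'E ?e2 ?e'2 ?subX //.
  by apply/forallP => i; rewrite same.
have /cards1P[a' ea'] : #|e| == 1.
  by rewrite eqn_leq -ltnS ltn_neqAle e2 rankE //=; apply/card_gt0P; exists a.
(* When [e] is a single vertex, every vertex of [e'] has its code in all coordinates. *)
have sub b : b \in e' -> b = a'.
  move=> be'; apply: finj; first exact: (subsetP (subX _ e'E)).
    by apply: (subsetP (subX _ eE)); rewrite ea' set11.
  apply/ffunP => i; have : coordinate V _ _ f i b \in coordinate V _ _ f i @: e by rewrite same imset_f.
  by rewrite ea' imset_set1 inE !ffunE => /eqP.
have [b be'] : exists b, b \in e'.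
  by apply/card_gt0P; apply: leq_trans ee'; apply/card_gt0P; exists a.
by apply/setP => z; rewrite ea' inE; apply/eqP/idP => [->|/sub //]; rewrite -(sub b).
Qed.

(** The all-true code is reserved for the empty edge, which every test contains; the remaining
    [2 ^ k - 1] codes suffice for [E]. *)
Lemma singleton_tests (V : finType) (E : {set {set V}}) (k : nat) :
  (forall e, e \in E -> #|e| <= 1) -> #|E| < 2 ^ k ->
  exists tests : seq {set V}, identifies E tests /\ size tests = k.
Proof.
move=> rankE hk; pose top : {ffun 'I_k -> bool} := [ffun=> true].
pose codes := enum (predC1 top).
pose c (e : {set V}) := nth top codes (index e (enum E)).
have idx e : e \in E -> index e (enum E) < size codes.
  move=> eE; apply: (@leq_trans #|E|); first by rewrite cardE index_mem mem_enum.
  by rewrite -cardE cardC1 card_ffun card_bool card_ord -ltnS prednK // expn_gt0.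
have c_top e : e \in E -> c e != top.
  by move=> eE; have := mem_nth top (idx e eE); rewrite mem_enum.
have c_inj : {in E &, injective c}.
  move=> e e' eE e'E /eqP; rewrite nth_uniq ?idx ?enum_uniq // => /eqP eqi.
  by rewrite -(nth_index set0 (s := enum E) (x := e)) ?mem_enum // eqi nth_index ?mem_enum.
exists [seq [set v | c [set v] i] | i <- enum 'I_k]; split; last first.
  by rewrite size_map size_enum_ord.
apply: identifies_card_le => e e' eE e'E ee' eq_out.
have out i : test_outcome [set v | c [set v] i] e = test_outcome [set v | c [set v] i] e'.
  by apply: eq_out; apply/mapP; exists i; rewrite ?mem_enum.
have card1 (f : {set V}) : f \in E -> f != set0 -> exists v, f = [set v].
  by move=> fE f0; apply/cards1P; rewrite eqn_leq rankE //= card_gt0.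
have single v i : test_outcome [set u | c [set u] i] [set v] = c [set v] i.
  by rewrite /test_outcome sub1set inE.
have [e'0|e'0] := eqVneq e' set0.
  by move: ee'; rewrite e'0 cards0 leqn0 cards_eq0 => /eqP.
have [v e'v] := card1 e' e'E e'0.
have [e0|e0] := eqVneq e set0.
  have /negP[] := c_top e' e'E; apply/eqP/ffunP => i; rewrite ffunE.
  by rewrite e'v -single -e'v -out /test_outcome e0 sub0set.
have [u eu] := card1 e eE e0.
apply: c_inj => //; apply/ffunP => i; rewrite [in LHS]eu [in RHS]e'v -!single -eu -e'v.
exact: out.
Qed.

End SmallRankTests.

From mathcomp Require Import all_classical all_reals.
From mathcomp Require Import topology normedtype sequences exp.
Import numFieldNormedType.Exports.

(** * Numbers of tests proportional to the logarithm *)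

Section LogarithmicTests.
Variable R : realType.

(** The constant [c] is fixed before the hypergraph, so that it becomes an error term after division
    by [ln #|E|]. *)
Definition testable_at_rate (d : nat) (rho : R) := exists c : R,
  forall (V : finType) (E : {set {set V}}), (forall e, e \in E -> (#|e| <= d)%N) ->
    (1 < #|E|)%N -> exists tests : seq {set V},
      identifies E tests /\ (size tests)%:R <= rho * ln #|E|%:R + c.

Lemma exprn_expR (x : R) k : 0 < x -> x ^+ k = expR (k%:R * ln x).
Proof. by move=> x0; rewrite expRM_natl lnK. Qed.

Lemma ln_lt0_itv (x : R) : ln x < 0 -> 0 < x < 1.
Proof.
move=> lx; have [x0|x0] := leP x 0; first by move: lx; rewrite ln0 ?ltxx.
by rewrite /= ltNge; apply: contraTN lx => /ln_ge0; rewrite -leNgt.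
Qed.

Lemma exists_expr_lt (x eps : R) : 0 < x < 1 -> 0 < eps -> exists k, x ^+ k < eps.
Proof.
move=> /andP[x0 x1] e0; have lx : ln x < 0 by rewrite ln_lt0 ?x0.
exists (Num.truncn (ln eps / ln x)).+1; rewrite exprn_expR // -[ltRHS]lnK //.
by rewrite ltr_expR -ltr_ndivrMr // truncnS_gt.
Qed.

(** With [L = ln #|E|] everything is an exponential: the part proportional to [L] has nonpositive
    exponent, and [k0] surplus blocks leave the factor [x ^+ k0]. *)
Lemma rate_bound (x y a L kap kap2 : R) k0 k k2 : 0 < x <= 1 -> 0 < y <= 1 -> 0 <= L ->
  a + kap * ln x + kap2 * ln y <= 0 -> kap * L + k0%:R <= k%:R -> kap2 * L <= k2%:R ->
  expR (a * L) * x ^+ k * y ^+ k2 <= x ^+ k0.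
Proof.
move=> /andP[x0 x1] /andP[y0 y1] L0 ha hk hk2.
rewrite !exprn_expR // -!expRD ler_expR.
have lx := ln_le0 x1; have ly := ln_le0 y1.
have h1 := ler_wnM2r lx hk; have h2 := ler_wnM2r ly hk2.
have h3 := mulr_le0_ge0 ha L0.
by move: h1 h2 h3; set u := ln x; set v := ln y; lra.
Qed.

(** As [z <= 1], [x ^+ 2 <= x], and the sum stays below [(2 + 2 t + t ^+ 2) z < 1]. *)
Lemma small_weighted_sum (t x a b c : R) : let z := (4 + 2 * t + t ^+ 2)^-1 in
  0 <= t -> 0 <= x -> x < z -> a < z -> b < z -> c < z ->
  x ^+ 2 + t * x + t ^+ 2 * a + b + t * c < 1.
Proof.
move=> z t0 x0 xz az bz cz; have t2 := sqr_ge0 t.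
have C0 : 0 < 4 + 2 * t + t ^+ 2 by move: t2; set u := t ^+ 2; lra.
have Cz : (4 + 2 * t + t ^+ 2) * z = 1 by rewrite divff // gt_eqF.
have h1 : t * x <= t * z by rewrite ler_wpM2l // ltW.
have h2 : t ^+ 2 * a <= t ^+ 2 * z by rewrite ler_wpM2l // ltW.
have h3 : t * c <= t * z by rewrite ler_wpM2l // ltW.
have z1 : z <= 1 by rewrite invf_le1 //; move: t2; set u := t ^+ 2; lra.
have h4 : x ^+ 2 <= x by rewrite expr2 ler_piMr //; lra.
have z0 : 0 < z by rewrite invr_gt0.
clearbody z; lra.
Qed.

Lemma small_union_bound (t n T S H W D : R) : let z := (4 + 2 * t + t ^+ 2)^-1 in
  0 <= t -> 0 <= n * T -> n * T < z -> n * (n / D) * S < z -> n ^+ 2 * S * H < z ->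
  n * D * S * W < z ->
  (n * T) ^+ 2 + t * n * T + t * n * (t * n / D) * S + n ^+ 2 * S * H + t * n * D * S * W < 1.
Proof.
move=> z t0 x0 xz az bz cz.
have -> : t * n * T = t * (n * T) by ring.
have -> : t * n * (t * n / D) * S = t ^+ 2 * (n * (n / D) * S) by ring.
have -> : t * n * D * S * W = t * (n * D * S * W) by ring.
exact: small_weighted_sum.
Qed.

(* [kap] and [kap2] are the numbers of blocks and of swap tests per unit of [ln #|E|]; vertices
   are heavy above degree [#|E| ^ (1 - r)]. *)
Lemma testable_of_params (d m : nat) (kap kap2 r : R) :
  let q : R := m%:R in
  let th := hit1 q d.-1 in
  let s := q^-1 + (1 - q^-1) * hit2 q d.-1 in
  (2 <= d)%N -> (1 < m)%N -> 0 <= kap -> 0 <= kap2 -> 0 <= r ->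
  (q * hit1 q d.-2 + q * (q - 1) * hit2 q d.-2 + 2) / q ^+ 2 <= th ^+ 2 ->
  1 + kap * ln th <= 0 ->
  1 + r + kap * ln s <= 0 ->
  2 + kap * ln s - kap2 * ln 2 <= 0 ->
  2 - r + kap * ln s + kap2 * ln (1 - 2 ^- d) <= 0 ->
  testable_at_rate d (q * kap + kap2).
Proof.
move=> q th s d2 m1 kap0 kap20 r0 hB hA h3 h4 h5.
have lth : ln th < 0.
  by rewrite ltNge; apply/negP => l; have := mulr_ge0 kap0 l; move: hA; set u := kap * _; lra.
have ls : ln s < 0.
  by rewrite ltNge; apply/negP => l; have := mulr_ge0 kap0 l; move: h3; set u := kap * _; lra.
have /andP[th0 th1] := ln_lt0_itv _ lth; have /andP[s0 s1] := ln_lt0_itv _ ls.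
have d_ge0 : 0 <= d%:R :> R by rewrite ler0n.
pose C : R := 4 + 2 * d%:R + d%:R ^+ 2.
have C1 : 1 < C by rewrite /C; have := sqr_ge0 (d%:R : R); lra.
have C0 : 0 < C by lra.
(* [k0] depends only on the parameters, and makes every contribution to the union bound small
   uniformly in the hypergraph. *)
have [k0 hk0] : exists k0, Num.max th s ^+ k0 < C^-1.
  apply: exists_expr_lt; last by rewrite invr_gt0.
  by rewrite lt_max th0 gt_max th1 s1.
have thk0 : th ^+ k0 < C^-1.
  by apply: le_lt_trans hk0; apply: lerXn2r; rewrite ?nnegrE ?le_max ?lexx ?(ltW th0).
have sk0 : s ^+ k0 < C^-1.
  by apply: le_lt_trans hk0; apply: lerXn2r; rewrite ?nnegrE ?le_max ?lexx ?(ltW s0) ?orbT.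
(* The constant pays for [k0] surplus blocks and for rounding up by one block and one swap test. *)
exists (q * (k0%:R + 1) + 1) => V E rankE E1.
set L := ln #|E|%:R.
have N0 : 0 < #|E|%:R :> R by rewrite ltr0n (ltnW E1).
have L0 : 0 <= L by rewrite ln_ge0 // ler1n ltnW.
have NE : #|E|%:R = expR L by rewrite lnK.
set k := (k0 + (Num.truncn (kap * L)).+1)%N; set k2 := (Num.truncn (kap2 * L)).+1.
have hk : kap * L + k0%:R <= k%:R.
  by rewrite natrD addrC lerD2l ltW // truncnS_gt.
have hk2 : kap2 * L <= k2%:R by rewrite ltW // truncnS_gt.
have y1 : 0 < (1:R) <= 1 by rewrite ltr01 lexx.
have y2 : 0 < (2^-1 : R) <= 1 by lra.
have pow2 : 2 ^- d < 1 :> R.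
  by rewrite invf_lt1 ?exprn_gt0 // exprn_egt1 ?ltr1n // -lt0n ltnW.
have y3 : 0 < (1 - 2 ^- d : R) <= 1.
  by rewrite subr_gt0 pow2 gerBl invr_ge0 exprn_ge0.
have thI : 0 < th <= 1 by rewrite th0 ltW.
have sI : 0 < s <= 1 by rewrite s0 ltW.
have bA : #|E|%:R * th ^+ k <= th ^+ k0.
  have hA' : 1 + kap * ln th + kap2 * ln 1 <= 0 by rewrite ln1 mulr0 addr0.
  by have := rate_bound _ _ _ _ _ _ _ _ _ thI y1 L0 hA' hk hk2; rewrite expr1n mulr1 mul1r -NE.
pose D := expR ((1 - r) * L).
have b3 : #|E|%:R * (#|E|%:R / D) * s ^+ k <= s ^+ k0.
  have h3' : 1 + r + kap * ln s + kap2 * ln 1 <= 0 by rewrite ln1 mulr0 addr0.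
  have := rate_bound _ _ _ _ _ _ _ _ _ sI y1 L0 h3' hk hk2; rewrite expr1n mulr1.
  suff -> : expR ((1 + r) * L) = #|E|%:R * (#|E|%:R / D) by [].
  by rewrite /D NE -expRN -!expRD; congr expR; ring.
have b4 : #|E|%:R ^+ 2 * s ^+ k * 2^-1 ^+ k2 <= s ^+ k0.
  have h4' : 2 + kap * ln s + kap2 * ln 2^-1 <= 0 by rewrite lnV ?posrE // mulrN.
  have := rate_bound _ _ _ _ _ _ _ _ _ sI y2 L0 h4' hk hk2.
  by rewrite NE -[expR L ^+ 2]expRM_natl.
have b5 : #|E|%:R * D * s ^+ k * (1 - 2 ^- d) ^+ k2 <= s ^+ k0.
  have := rate_bound _ _ _ _ _ _ _ _ _ sI y3 L0 h5 hk hk2.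
  suff -> : expR ((2 - r) * L) = #|E|%:R * D by [].
  by rewrite /D NE -!expRD; congr expR; ring.
have [||tests [idt szt]] := exists_tests_of_small_sum R V E d m k k2 D rankE m1 _ hB.
- exact: expR_gt0.
- rewrite -/q -/th -/s; apply: small_union_bound => //.
  + by rewrite mulr_ge0 ?ler0n // exprn_ge0 // ltW.
  + exact: le_lt_trans thk0.
  + exact: le_lt_trans sk0.
  + exact: le_lt_trans sk0.
  + exact: le_lt_trans sk0.
exists tests; split=> //; rewrite szt natrD natrM -/q.
have u1 : (Num.truncn (kap * L))%:R <= kap * L by rewrite truncn_le // mulr_ge0.
have u2 : (Num.truncn (kap2 * L))%:R <= kap2 * L by rewrite truncn_le // mulr_ge0.
have q0 : 0 <= q by rewrite ler0n.
have := ler_wpM2l q0 u1; rewrite /k /k2 natrD -!natr1.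
move: u2; clearbody L q; move: (_%:R) (_%:R) (k0%:R) => a b c; clear; lra.
Qed.

End LogarithmicTests.

(** * Numerical estimates and ranks three to six *)

Section Numerics.
Variable R : realType.
Local Notation l := (ln (2 : R)).

Lemma expR_ge_quadratic (x : R) : 0 <= x -> 1 + x + x ^+ 2 / 2 <= expR x.
Proof.
move=> x0; have ndec : nondecreasing_seq (series (exp_coeff x)).
  apply/nondecreasing_seqP => n; rewrite /series /= big_nat_recr //= lerDl.
  by rewrite /exp_coeff /= divr_ge0 ?exprn_ge0.
have := nondecreasing_cvgn_le ndec (is_cvg_series_exp_coeff x) 3; apply: le_trans.
rewrite /series /= !big_nat_recr //= big_geq // /exp_coeff /=.
by rewrite expr0 expr1 !divr1 add0r.
Qed.

Lemma ln2_gt0 : 0 < l. Proof. by rewrite ln_gt0 // ltr1n. Qed.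

Lemma ln2_le : l <= 25 / 36.
Proof.
rewrite -ler_expR lnK ?posrE //.
(* At an eighth of the exponent the quadratic Taylor bound is sharp enough; [253 / 232] lies just
   below it and its eighth power exceeds 2. *)
have -> : 25 / 36 = 8%:R * (25 / 288) :> R by lra.
rewrite expRM_natl.
have h : 1 + 25 / 288 + (25 / 288) ^+ 2 / 2 <= expR (25 / 288 : R).
  by apply: expR_ge_quadratic; lra.
have {h} h : 253 / 232 <= expR (25 / 288 : R) by apply: le_trans h; lra.
apply: le_trans (_ : (253 / 232) ^+ 8 <= _); first lra.
by apply: lerXn2r; rewrite ?nnegrE ?expR_ge0 //; lra.
Qed.

(** Reduces numerical bounds on logarithms to inequalities between rational powers. *)
Lemma ln_le_of_exprn (x : R) a b : 0 < x -> x ^+ b <= 2^-1 ^+ a -> b%:R * ln x <= - (a%:R * l).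
Proof.
move=> x0 h; have : ln (x ^+ b) <= ln (2^-1 ^+ a).
  by rewrite ler_ln ?posrE ?exprn_gt0 ?invr_gt0.
by rewrite !lnXn ?invr_gt0 // lnV ?posrE // mulNrn !mulr_natl.
Qed.

Lemma testable_rate_le (d : nat) (rho rho' : R) : rho <= rho' ->
  testable_at_rate R d rho -> testable_at_rate R d rho'.
Proof.
move=> le_rho [c hc]; exists c => V E rankE E1.
have [tests [idt szt]] := hc V E rankE E1; exists tests; split=> //.
by apply: (le_trans szt); rewrite lerD2r ler_wpM2r // ln_ge0 // ler1n ltnW.
Qed.

(** The parameters are [r = 1 / 2], [kap = b / (a l)] and [kap2 = 1 / (2 l)]; then
    [kap * ln th <= -1] and [kap * ln s <= - (3 / 2)]. The last hypothesis compares the rates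
    through [l <= 25 / 36]. *)
Lemma testable_half (d m a b : nat) :
  let q : R := m%:R in
  let th := hit1 q d.-1 in
  let s := q^-1 + (1 - q^-1) * hit2 q d.-1 in
  (2 <= d)%N -> (1 < m)%N -> (0 < a)%N ->
  (q * hit1 q d.-2 + q * (q - 1) * hit2 q d.-2 + 2) / q ^+ 2 <= th ^+ 2 ->
  0 < th -> 0 < s -> th ^+ b <= 2^-1 ^+ a -> s ^+ (2 * b) <= 2^-1 ^+ (3 * a) ->
  (q * (b%:R / a%:R) + 1 / 2) * (25 / 36) <= d%:R ->
  testable_at_rate R d (d%:R / l ^+ 2).
Proof.
move=> q th s d2 m1 a0 hB th0 s0 hth hs hq.
have l0 := ln2_gt0; have ln0 : l != 0 by rewrite gt_eqF.
have a0' : 0 < a%:R :> R by rewrite ltr0n.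
have an0 : a%:R != 0 :> R by rewrite gt_eqF.
have hth' := ln_le_of_exprn _ _ _ th0 hth.
have hs' := ln_le_of_exprn _ _ _ s0 hs.
pose kap := b%:R / (a%:R * l).
have kth : kap * ln th <= -1.
  have -> : kap * ln th = b%:R * ln th / (a%:R * l) by rewrite /kap; field; rewrite ?ln0 ?an0.
  by rewrite ler_pdivrMr ?mulr_gt0 // mulN1r.
have ks : kap * ln s <= - (3 / 2).
  have -> : kap * ln s = (2 * b)%:R * ln s / (2 * a%:R * l).
    by rewrite /kap natrM; field; rewrite ?ln0 ?an0.
  rewrite ler_pdivrMr ?mulr_gt0 //.
  suff <- : - ((3 * a)%:R * l) = - (3 / 2) * (2 * a%:R * l) by [].
  by rewrite natrM; field.
apply: (testable_rate_le _ (q * kap + 1 / 2 / l)).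
  rewrite ler_pdivlMr ?exprn_gt0 //.
  have -> : (q * kap + 1 / 2 / l) * l ^+ 2 = (q * (b%:R / a%:R) + 1 / 2) * l.
    by rewrite /kap; field; rewrite ?ln0 ?an0.
  apply: le_trans hq; apply: ler_wpM2l; last exact: ln2_le.
  by apply: addr_ge0; [apply: mulr_ge0; rewrite ?divr_ge0 ?ler0n|lra].
have k0 : 0 <= kap by rewrite divr_ge0 ?mulr_ge0 ?ler0n // ltW.
apply: (testable_of_params R d m kap _ (1 / 2)) => //.
- by rewrite !divr_ge0 ?ler0n // ltW.
- by rewrite divr_ge0 ?ler0n.
- by move: kth; rewrite -/q -/th; set u := kap * _; lra.
- by move: ks; rewrite -/q -/s; set u := kap * _; lra.
- rewrite -/q -/s mulfVK //; move: ks; set u := kap * _; lra.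
- rewrite -/q -/s; have : 1 / 2 / l * ln (1 - 2 ^- d) <= 0.
    apply: mulr_ge0_le0; first by rewrite !divr_ge0 ?ler0n // ltW.
    by apply: ln_le0; rewrite gerBl invr_ge0 exprn_ge0.
  move: ks; set u := kap * _; set v := _ * ln _; lra.
Qed.

(** With [m = 4], the value [r = 1 / 2] would need too many blocks. Taking [r = 9 / 20] saves
    blocks, and the swap tests, through [ln (7 / 8)], make up for it on intersections with a light
    vertex. *)
Lemma testable3 : testable_at_rate R 3 (3 / l ^+ 2).
Proof.
have thE : hit1 4%:R 2 = 7 / 16 :> R by rewrite /hit1; field.
have sE : 4%:R^-1 + (1 - 4%:R^-1) * hit2 4%:R 2 = 11 / 32 :> R by rewrite /hit2; field.
have l0 := ln2_gt0; have ln0 : l != 0 by rewrite gt_eqF.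
have il0 : 0 < l^-1 by rewrite invr_gt0.
have hth : 8%:R * ln (7 / 16 : R) <= - (9%:R * l) by apply: ln_le_of_exprn; lra.
have hs : 13%:R * ln (11 / 32 : R) <= - (20%:R * l) by apply: ln_le_of_exprn; lra.
have h7 : 11%:R * ln (7 / 8 : R) <= - (2%:R * l) by apply: ln_le_of_exprn; lra.
have scale (x v : R) : x <= - (v * l) -> x / l <= - v.
  by move=> h; rewrite ler_pdivrMr // mulNr.
apply: (testable_rate_le _ (4%:R * (377 / 400 / l) + 11 / 20 / l)).
  rewrite ler_pdivlMr ?exprn_gt0 //.
  have -> : (4%:R * (377 / 400 / l) + 11 / 20 / l) * l ^+ 2 = 108 / 25 * l by field.
  by have := ln2_le; lra.
apply: (testable_of_params R 3 4 _ _ (9 / 20)) => //=; rewrite ?thE ?sE.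
- by rewrite !divr_ge0 // ltW.
- by rewrite !divr_ge0 // ltW.
- by rewrite divr_ge0.
- by rewrite /hit1 /hit2; lra.
- have := scale _ _ hth; set u := ln _.
  have -> : 377 / 400 / l * u = 377 / 400 / 8 * (8%:R * u / l) by field.
  lra.
- have := scale _ _ hs; set u := ln _.
  have -> : 377 / 400 / l * u = 377 / 400 / 13 * (13%:R * u / l) by field.
  lra.
- have := scale _ _ hs; set u := ln _; rewrite mulfVK //.
  have -> : 377 / 400 / l * u = 377 / 400 / 13 * (13%:R * u / l) by field.
  lra.
- have -> : 1 - 2 ^- 3 = 7 / 8 :> R by lra.
  have := scale _ _ hs; have := scale _ _ h7; set u := ln (11 / 32); set v := ln _.
  have -> : 377 / 400 / l * u = 377 / 400 / 13 * (13%:R * u / l) by field.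
  have -> : 11 / 20 / l * v = 1 / 20 * (11%:R * v / l) by field.
  lra.
Qed.

(** The four numbers are [d], [m], [a] and [b] of [testable_half], whose conditions become rational
    inequalities. *)
Lemma testable4 : testable_at_rate R 4 (4 / l ^+ 2).
Proof. by apply: (testable_half 4 6 7 6); rewrite ?/hit1 ?/hit2 //=; lra. Qed.

Lemma testable5 : testable_at_rate R 5 (5 / l ^+ 2).
Proof. by apply: (testable_half 5 8 5 4); rewrite ?/hit1 ?/hit2 //=; lra. Qed.

Lemma testable6 : testable_at_rate R 6 (6 / l ^+ 2).
Proof. by apply: (testable_half 6 9 9 8); rewrite ?/hit1 ?/hit2 //=; lra. Qed.

End Numerics.

(** * Ranks at least seven *)

Section LargeRank.
Variable R : realType.
Local Notation l := (ln (2 : R)).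

(** The fraction is the mean of [1 / q] and [1 / (q - 1)], that is, the trapezoidal overestimate of
    the integral of [1 / x] from [q - 1] to [q]. *)
Lemma ln_1Binv_ge (q : R) : 1 < q -> - ((q - 1 / 2) / (q * (q - 1))) <= ln (1 - q^-1).
Proof.
move=> q1; have q0 : 0 < q by lra.
have qn0 : q != 0 by rewrite gt_eqF.
have q1n0 : q - 1 != 0 by rewrite subr_eq0 gt_eqF.
have i1 : 0 < 1 - q^-1 by rewrite subr_gt0 invf_lt1.
set c := (X in - X); have c0 : 0 <= c by rewrite divr_ge0 ?mulr_ge0; lra.
rewrite -ler_expR lnK ?posrE // expRN -[leRHS]invrK lef_pV2 ?posrE ?invr_gt0 ?expR_gt0 //.
apply: le_trans (expR_ge_quadratic R c c0); rewrite -subr_ge0.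
have -> : 1 + c + c ^+ 2 / 2 - (1 - q^-1)^-1 = (1 / 4) / (2 * q ^+ 2 * (q - 1) ^+ 2).
  by rewrite /c; field; rewrite qn0 q1n0.
rewrite divr_ge0 ?mulr_ge0 ?sqr_ge0 ?ler0n //; lra.
Qed.

(** Occurrences of two letters are negatively correlated, since [1 - 2 / q <= (1 - 1 / q) ^+ 2]. *)
Lemma hit2_le_sqr (q : R) c : 2 <= q -> hit2 q c <= hit1 q c ^+ 2.
Proof.
move=> q2; have q0 : 0 < q by lra.
have h : (1 - 2 / q) ^+ c <= ((1 - q^-1) ^+ 2) ^+ c.
  apply: lerXn2r; rewrite ?nnegrE ?sqr_ge0 //.
    by rewrite subr_ge0 ler_pdivrMr // mul1r.
  by have := sqr_ge0 q^-1; rewrite !expr2; lra.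
move: h; rewrite /hit2 /hit1 exprAC; set x := _ ^+ c; set y := _ ^+ c.
by rewrite !expr2; lra.
Qed.

(** The comparison of rates for [A = (d - 1) / l], block length [M + 1 / 2] and [il = l^-1], with
    [36 / 25] taken from [ln2_le]; note [36 / 25 - 1 / 2 = 47 / 50]. *)
Lemma rate_polynomial (A M il : R) : 8 <= A -> A <= M -> M <= A + 1 -> 36 / 25 <= il ->
  M + 1 / 2 <= (2 - A * ((M + 1 / 2 - 1 / 2) / ((M + 1 / 2) * (M + 1 / 2 - 1)))) * (A + il - 1 / 2).
Proof.
move=> A8 AM MA il0.
have t0 : 0 < (M + 1 / 2) * (M + 1 / 2 - 1) by rewrite mulr_gt0; lra.
set t := (M + 1 / 2) * _ in t0 *.
have -> : M + 1 / 2 - 1 / 2 = M by lra.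
have tE : t = M ^+ 2 - 1 / 4 by rewrite /t; field.
have AMt : A * M <= 2 * t by rewrite tE; nra.
have c1 : 0 <= 2 - A * (M / t) by rewrite subr_ge0 mulrA ler_pdivrMr.
apply: (le_trans (y := (2 - A * (M / t)) * (A + 47 / 50))); last by apply: ler_wpM2l => //; lra.
have -> : (2 - A * (M / t)) * (A + 47 / 50) = ((2 * t - A * M) * (A + 47 / 50)) / t.
  by field; rewrite gt_eqF.
rewrite ler_pdivlMr // tE.
(* In terms of [M] and [e = M - A] the cubic terms cancel, and the surplus [(11 / 25) M ^+ 2]
   absorbs the rest for [M >= 8]. *)
have -> : A = M - (M - A) by lra.
have e0 : 0 <= M - A by lra.
have e1 : M - A <= 1 by lra.
move: (M - A) e0 e1 => e e0 e1.
have M8 : 8 <= M by lra.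
have M0 : 0 <= M by lra.
have p1 : M * e <= M * 1 by apply: ler_wpM2l.
have p2 : M * e * e <= M * e * 1 by apply: ler_wpM2l => //; exact: mulr_ge0.
have p3 : M * 8 <= M * M by apply: ler_wpM2l.
rewrite !expr2; clear -e0 e1 M8 p1 p2 p3; lra.
Qed.

(** The two factors are bounded by functions of [phi] monotone in opposite directions, so on each of
    four short intervals they are evaluated at opposite ends. *)
Lemma swap_polynomial (j phi : R) : 0 <= j -> j <= 1 / 10 ->
  49 / 100 <= phi -> phi <= 56 / 100 ->
  (j + (1 - j) * (1 - phi) ^+ 2) ^+ 2 * (4 * phi) ^+ 3 <= 1.
Proof.
move=> j0 j1 lo hi; set u := j + _.
have u0 : 0 <= u by rewrite addr_ge0 // mulr_ge0 ?sqr_ge0 //; lra.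
have uE : u <= 1 / 10 + 9 / 10 * (1 - phi) ^+ 2.
  have p2 : (1 - phi) ^+ 2 <= 1 by rewrite expr2; nra.
  by rewrite /u; move: p2; set v := _ ^+ 2; nra.
have step (a b c : R) : 0 <= a -> a <= phi -> phi <= b -> b <= 1 ->
   1 / 10 + 9 / 10 * (1 - a) ^+ 2 <= c -> c ^+ 2 * (4 * b) ^+ 3 <= 1 ->
   u ^+ 2 * (4 * phi) ^+ 3 <= 1.
  move=> a0 ap pb b1 hc; apply: le_trans; apply: ler_pM; rewrite ?exprn_ge0 //; first lra.
    apply: lerXn2r; rewrite ?nnegrE //.
      by apply: le_trans hc; apply: addr_ge0; [lra|apply: mulr_ge0; [lra|exact: sqr_ge0]].
    apply: (le_trans uE); apply: le_trans hc.
    have : (1 - phi) ^+ 2 <= (1 - a) ^+ 2 by apply: lerXn2r; rewrite ?nnegrE; lra.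
    by lra.
  by apply: lerXn2r; rewrite ?nnegrE; lra.
have [h1|h1] := leP phi (51 / 100).
  by apply: (step (49 / 100) (51 / 100) (34 / 100)); lra.
have [h2|h2] := leP phi (53 / 100).
  by apply: (step (51 / 100) (53 / 100) (32 / 100)); lra.
have [h3|h3] := leP phi (55 / 100).
  by apply: (step (53 / 100) (55 / 100) (30 / 100)); lra.
by apply: (step (55 / 100) (56 / 100) (29 / 100)); lra.
Qed.

Lemma rate_le (q Y A L : R) : 0 < L -> 0 < Y -> q * L <= Y * (A + L^-1 - 1 / 2) ->
  q * Y^-1 + 1 / 2 / L <= (A * L + 1) / L ^+ 2.
Proof.
move=> L0 Y0 h; have Ln0 : L != 0 by rewrite gt_eqF.
have Yn0 : Y != 0 by rewrite gt_eqF.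
have {}h : q * L / Y <= A + L^-1 - 1 / 2 by rewrite ler_pdivrMr // [leRHS]mulrC.
rewrite -(ler_pM2r L0).
have -> : (A * L + 1) / L ^+ 2 * L = A + L^-1 by field.
have -> : (q * Y^-1 + 1 / 2 / L) * L = q * L / Y + 1 / 2 by field; rewrite Yn0 Ln0.
by lra.
Qed.

Lemma big_collision_le (q : R) n : 10 <= q ->
  49 / 100 <= (1 - q^-1) ^+ n.+1 -> (1 - q^-1) ^+ n.+1 <= 56 / 100 ->
  (q * hit1 q n + q * (q - 1) * hit2 q n + 2) / q ^+ 2 <= hit1 q n.+1 ^+ 2.
Proof.
move=> q10; rewrite (exprS _ n) => lo hi.
have q0 : 0 < q by lra.
have qn0 : q != 0 by rewrite gt_eqF.
have j1 : q^-1 <= 1 / 10 by rewrite div1r lef_pV2 ?posrE.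
have j0 : 0 < q^-1 by rewrite invr_gt0.
have h2 : hit2 q n <= hit1 q n ^+ 2 by apply: hit2_le_sqr; lra.
move: lo hi h2; rewrite [hit1 q n.+1]/hit1 (exprS _ n) /hit1; move: (hit2 q n) => H.
set psi := (1 - q^-1) ^+ n => lo hi h2.
have psi0 : 0 < psi by rewrite exprn_gt0; lra.
have psi_ge : 49 / 100 <= psi by apply: (le_trans lo); rewrite ler_piMl ?ltW //; lra.
have psi_le : 9 / 10 * psi <= 56 / 100.
  by apply: le_trans hi; apply: ler_wpM2r; [exact: ltW|lra].
rewrite ler_pdivrMr ?exprn_gt0 //.
have -> : (1 - (1 - q^-1) * psi) ^+ 2 * q ^+ 2 = (q - (q - 1) * psi) ^+ 2 by field.
have h3 : q * (q - 1) * H <= q * (q - 1) * (1 - psi) ^+ 2.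
  by apply: ler_wpM2l => //; rewrite mulr_ge0; lra.
(* After [hit2 <= hit1 ^+ 2] the claim is equivalent to this inequality; [psi] lies between
   [49 / 100] and [28 / 45]. *)
have h4 : 2 <= psi * (1 + (q - 1) * (1 - psi)).
  have : 9 * (1 - psi) <= (q - 1) * (1 - psi) by apply: ler_wpM2r; lra.
  clear -psi_ge psi_le psi0; move: ((q - 1) * _) => u hu.
  have : psi * (1 + 9 * (1 - psi)) <= psi * (1 + u) by apply: ler_wpM2l; lra.
  apply: le_trans; nra.
by clear -h3 h4; move: h3 h4; rewrite !expr2; lra.
Qed.

(** The power is the probability that [n.+1] vertices all miss a given letter; it is near 1/2
    because [q] is near [n.+1 / l]. *)
Lemma miss_probability_bounds (q : R) n : let A := n.+1%:R / l in
  6 <= n.+1%:R :> R -> A + 1 / 2 < q -> q <= A + 3 / 2 ->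
  [/\ 49 / 100 <= (1 - q^-1) ^+ n.+1, (1 - q^-1) ^+ n.+1 <= 56 / 100 &
    l * (2 - A * ((q - 1 / 2) / (q * (q - 1)))) <= ln (4 * (1 - q^-1) ^+ n.+1)].
Proof.
move=> A D6 q_gt q_le; have l0 := ln2_gt0 R; have lu := ln2_le R.
have ln0 : l != 0 by rewrite gt_eqF.
have A8 : 216 / 25 <= A by rewrite ler_pdivlMr //; lra.
have DE : n.+1%:R = A * l :> R by rewrite /A mulfVK.
clearbody A.
have q9 : 9 <= q by lra.
have q0 : 0 < q by lra.
have j0 : 0 < q^-1 by rewrite invr_gt0.
have i0 : 0 < 1 - q^-1 by rewrite subr_gt0 invf_lt1 //; lra.
set phi := (1 - q^-1) ^+ n.+1.
have phi0 : 0 < phi by rewrite exprn_gt0.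
have lnphi : ln phi = A * l * ln (1 - q^-1) by rewrite lnXn // -DE mulr_natl.
clearbody phi; set c := (q - 1 / 2) / (q * (q - 1)).
have lnphi_ge : - (l * (A * c)) <= ln phi.
  rewrite lnphi mulrA [l * A]mulrC -mulrN ler_pM2l ?mulr_gt0 //; last lra.
  by apply: ln_1Binv_ge; lra.
(* [A < q - 1 / 2] gives [A (q - 1 / 2) < q (q - 1) + 1 / 4]. *)
have Ac : A * c <= 1 + 1 / 100.
  rewrite /c mulrA ler_pdivrMr; last by rewrite mulr_gt0; lra.
  by clear -q_gt q_le A8; nra.
have YE : ln (4 * phi) = 2 * l + ln phi.
  have -> : 4 = 2 ^+ 2 :> R by lra.
  by rewrite lnM ?posrE ?exprn_gt0 // lnXn // mulr_natl.
split.
- have : expR (- (l * (1 + 1 / 100))) <= phi.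
    rewrite -[leRHS]lnK // ler_expR; apply: le_trans lnphi_ge.
    by rewrite lerN2 ler_pM2l.
  have -> : - (l * (1 + 1 / 100)) = - l + - (l / 100) by lra.
  rewrite expRD expRN lnK ?posrE //; apply: le_trans.
  by have := expR_ge1Dx (- (l / 100)); clear -lu; lra.
- have h1 : ln phi <= - (A * l / q).
    rewrite lnphi -mulrN ler_pM2l; last by rewrite mulr_gt0 //; lra.
    by apply: le_ln1Dx; rewrite ltrN2 invf_lt1 //; lra.
  have h2 : - (A * l / q) <= - l + l * (3 / 20).
    have -> : - l + l * (3 / 20) = - (l * (17 / 20)) by lra.
    rewrite lerN2 ler_pdivlMr // -mulrA [A * l]mulrC ler_pM2l //; clear -q_le A8; lra.
  have : phi <= expR (- l + l * (3 / 20)).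
    by rewrite -[leLHS]lnK // ler_expR (le_trans h1).
  move=> h; apply: (le_trans h); rewrite expRD expRN lnK ?posrE //.
  have h3 : 1 - l * (3 / 20) <= (expR (l * (3 / 20)))^-1.
    by rewrite -expRN; apply: expR_ge1Dx.
  have h4 : (112 / 100)^-1 <= (expR (l * (3 / 20)))^-1 :> R.
    by apply: le_trans h3; clear -lu; lra.
  move: h4; rewrite lef_pV2 ?posrE ?expR_gt0 //; clear; lra.
- by rewrite YE; clear -lnphi_ge; lra.
Qed.

(** Here [d = A l + 1]: only [A l = d - 1] vertices enter [th], and the extra 1 leaves room for
    rounding [m] and for the swap tests. *)
Lemma testable_large (n : nat) : (5 <= n)%N ->
  testable_at_rate R n.+2 (n.+2%:R / l ^+ 2).
Proof.
move=> n5; have l0 := ln2_gt0 R; have lu := ln2_le R.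
have ln0 : l != 0 by rewrite gt_eqF.
pose A : R := n.+1%:R / l.
have D6 : 6 <= n.+1%:R :> R by rewrite ler_nat ltnS.
have A8 : 216 / 25 <= A by rewrite ler_pdivlMr //; lra.
have dE : n.+2%:R = A * l + 1 :> R by rewrite /A mulfVK // natr1.
pose m := (Num.truncn (A + 1 / 2)).+1; pose q : R := m%:R.
have q_gt : A + 1 / 2 < q by exact: truncnS_gt.
have q_le : q <= A + 3 / 2.
  have : (Num.truncn (A + 1 / 2))%:R <= A + 1 / 2 by rewrite truncn_le //; lra.
  by rewrite /q /m -[in leLHS]natr1; lra.
have m10 : (10 <= m)%N by rewrite -(ltr_nat R 9 m); apply: le_lt_trans q_gt; lra.
have [] := miss_probability_bounds q n D6 q_gt q_le.
rewrite -/A; set phi := (1 - q^-1) ^+ n.+1 => phi_ge phi_le Y_ge.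
have q10 : 10 <= q by rewrite ler_nat.
have big_le := big_collision_le q n q10 phi_ge phi_le.
have thE : hit1 q n.+1 = 1 - phi by [].
have phi0 : 0 < phi by apply: lt_le_trans phi_ge; lra.
have h2_le : hit2 q n.+1 <= (1 - phi) ^+ 2.
  by rewrite -thE hit2_le_sqr // (le_trans _ q10) // ler_nat.
have q2 : 2 <= q by apply: le_trans q10; rewrite ler_nat.
have h2_ge : 0 <= hit2 q n.+1.
  apply: le_trans (hit2_mono R q 0 n.+1 q2 (leq0n _)).
  by rewrite /hit2 !expr0; clear; lra.
clearbody phi; move: big_le; rewrite thE => big_le.
have q0 : 0 < q by apply: lt_le_trans q2.
have j0 : 0 < q^-1 by rewrite invr_gt0.
have j1 : q^-1 <= 1 / 10 by rewrite div1r lef_pV2 ?posrE.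
have i0 : 0 <= 1 - q^-1 by move: j1; clear; lra.
have Y0 : 0 < ln (4 * phi) by apply: ln_gt0; move: phi_ge; clear; lra.
pose s := q^-1 + (1 - q^-1) * hit2 q n.+1.
have s0 : 0 < s by rewrite ltr_pwDl // mulr_ge0.
have s_le : s <= q^-1 + (1 - q^-1) * (1 - phi) ^+ 2 by rewrite lerD2l ler_wpM2l.
have lns : ln s <= - (3 / 2) * ln (4 * phi).
  have : ln (s ^+ 2 * (4 * phi) ^+ 3) <= 0.
    apply: ln_le0; apply: le_trans (swap_polynomial q^-1 phi (ltW j0) j1 phi_ge phi_le).
    apply: ler_wpM2r; first by rewrite exprn_ge0 // mulr_ge0 // ltW.
    by apply: lerXn2r; rewrite ?nnegrE ?(ltW s0) // (le_trans _ s_le) // ltW.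
  rewrite lnM ?posrE ?exprn_gt0 ?mulr_gt0 // !lnXn ?mulr_gt0 //.
  by move: (ln s) (ln _) => u v; clear; lra.
have phi1 : 0 < 1 - phi by move: phi_le; clear; lra.
have lnth : ln (1 - phi) <= - ln (4 * phi).
  have : ln ((1 - phi) * (4 * phi)) <= 0.
    by apply: ln_le0; have := sqr_ge0 (1 - 2 * phi); rewrite !expr2; clear; lra.
  by rewrite lnM ?posrE ?mulr_gt0 //; move: (ln _) (ln _) => u v; clear; lra.
(* As [th = 1 - phi], this is the value for which [lnth] gives [kap * ln th <= -1] and [lns] gives
   [kap * ln s <= - (3 / 2)]. *)
pose kap := (ln (4 * phi))^-1.
have kap0 : 0 < kap by rewrite invr_gt0.
have kapY : kap * ln (4 * phi) = 1 by rewrite mulVf // gt_eqF.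
have ks : kap * ln s <= - (3 / 2).
  by have := ler_wpM2l (ltW kap0) lns; rewrite mulrCA kapY mulr1.
have kth : kap * ln (1 - phi) <= -1.
  by have := ler_wpM2l (ltW kap0) lnth; rewrite mulrN kapY.
apply: (testable_rate_le _ _ (q * kap + 1 / 2 / l)).
  have main : q <= (2 - A * ((q - 1 / 2) / (q * (q - 1)))) * (A + l^-1 - 1 / 2).
    have il : 36 / 25 <= l^-1.
      have -> : 36 / 25 = (25 / 36)^-1 :> R by rewrite invf_div.
      by rewrite lef_pV2 ?posrE // divr_gt0.
    have := rate_polynomial A (q - 1 / 2) l^-1.
    by rewrite subrK; apply => //; move: A8 q_gt q_le; clear; lra.
  have li0 : 0 < l^-1 by rewrite invr_gt0.
  have B0 : 0 <= A + l^-1 - 1 / 2 by move: li0 A8; clear; lra.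
  rewrite dE; apply: rate_le => //; rewrite mulrC.
  apply: (le_trans (ler_wpM2l (ltW l0) main)).
  by rewrite [leLHS]mulrA; apply: ler_wpM2r.
have k2 : 0 <= 1 / 2 / l by rewrite !divr_ge0 // ltW.
apply: (testable_of_params R n.+2 m kap _ (1 / 2)) => //=; rewrite -/q ?thE //.
- by rewrite ltnW // (leq_trans _ m10).
- exact: ltW.
- by rewrite divr_ge0.
- by move: kth; move: (kap * _) => u; clear; lra.
- by move: ks; rewrite /s; move: (kap * _) => u; clear; lra.
- by rewrite mulfVK //; move: ks; rewrite /s; move: (kap * _) => u; clear; lra.
- have : 1 / 2 / l * ln (1 - 2 ^- n.+2) <= 0.
    apply: mulr_ge0_le0 => //; apply: ln_le0.
    by rewrite gerBl invr_ge0 exprn_ge0.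
  by move: ks; rewrite /s; move: (kap * _) (1 / 2 / l * _) => u v; clear; lra.
Qed.

End LargeRank.

(** * Rates for ranks one and two, and all ranks together *)

Section SmallRank.
Variable R : realType.
Local Notation l := (ln (2 : R)).

(** Binary codes have rate [1 / l], which is at most [1 / l ^+ 2] because [l <= 1]. *)
Lemma testable1 : testable_at_rate R 1 (1 / l ^+ 2).
Proof.
have l0 := ln2_gt0 R; have lu := ln2_le R.
exists 1 => V E rankE E1; set L := ln #|E|%:R.
have N0 : 0 < #|E|%:R :> R by rewrite ltr0n (ltnW E1).
have L0 : 0 <= L by rewrite ln_ge0 // ler1n ltnW.
have [|tests [idt szt]] := singleton_tests V E (Num.truncn (L / l)).+1 rankE.
  rewrite -(ltr_nat R) natrX exprn_expR // -[ltLHS]lnK // ltr_expR.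
  by rewrite -ltr_pdivrMr // truncnS_gt.
exists tests; split=> //; rewrite szt -natr1 lerD2r.
apply: (le_trans (y := L / l)); first by rewrite truncn_le // divr_ge0 // ltW.
rewrite mul1r mulrC ler_wpM2r // lef_pV2 ?posrE ?exprn_gt0 // expr2 ler_piMl //; first exact: ltW.
lra.
Qed.

Lemma testable2 : testable_at_rate R 2 (2 / l ^+ 2).
Proof.
have l0 := ln2_gt0 R; have lu := ln2_le R.
have ln0 : l != 0 by rewrite gt_eqF.
pose t : R := ln 3.
have t0 : 0 < t by rewrite ln_gt0 // ltr1n.
have tn0 : t != 0 by rewrite gt_eqF.
have tl : 19 / 12 * l <= t.
  (* This is [2 ^ 19 <= 3 ^ 12], sharp enough for [3 * (3 / 2) / ln 3 <= 2 / l ^+ 2]. *)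
  have : ln ((1 + 1) ^+ 19) <= ln ((1 + 2) ^+ 12 : R) by rewrite ler_ln ?posrE ?exprn_gt0 //; lra.
  rewrite !lnXn; [|lra|lra].
  have -> : 1 + 1 = 2 :> R by lra.
  have -> : 1 + 2 = 3 :> R by lra.
  rewrite -/t; lra.
apply: (testable_rate_le _ _ (3 * (3 / 2 / t))).
  rewrite ler_pdivlMr ?exprn_gt0 //.
  have -> : 3 * (3 / 2 / t) * l ^+ 2 = (9 / 2 * l ^+ 2) / t by field.
  rewrite ler_pdivrMr //; apply: le_trans (_ : 2 * (19 / 12 * l) <= _); last by rewrite ler_pM2l.
  by rewrite expr2; nra.
exists (3 * (ln 4 / t + 1)) => V E rankE E1; set L := ln #|E|%:R.
have N0 : 0 < #|E|%:R :> R by rewrite ltr0n (ltnW E1).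
have L0 : 0 <= L by rewrite ln_ge0 // ler1n ltnW.
pose x := (3 / 2 * L + ln 4) / t.
have x0 : 0 <= x.
  by rewrite divr_ge0 ?(ltW t0) // addr_ge0 ?ln_ge0 ?mulr_ge0 //; lra.
have [j hj|tests [idt szt]] := graph_tests V E (Num.truncn x) rankE.
  pose S := expR (L / 2).
  have S1 : 1 <= S by rewrite -expR0 ler_expR divr_ge0.
  have NE : #|E|%:R = S * S by rewrite -expRD -[LHS]lnK // -/L; congr expR; lra.
  rewrite -(ltr_nat R) natrX natrD !natrM.
  have big : 4 * (S * S * S) < 3 ^+ (Num.truncn x).+1.
    have -> : 4 * (S * S * S) = expR (3 / 2 * L + ln 4).
      rewrite expRD lnK ?posrE // mulrC; congr (_ * _).
      by rewrite /S -!expRD; congr expR; lra.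
    by rewrite exprn_expR // ltr_expR -/t -ltr_pdivrMr // truncnS_gt.
  apply: le_lt_trans big; rewrite NE.
  have hj' : j%:R ^+ 2 <= 2 * (S * S).
    by rewrite -NE -natrX -[2]/(2%:R) -natrM ler_nat.
  (* With [S] the square root of [#|E|], this yields [j #|E| + 2 #|E| <= (3 / 2 + 2) S ^+ 3], below
     the [4 S ^+ 3] provided by the code length. *)
  have jS : j%:R <= 3 / 2 * S.
    rewrite -(ler_pXn2r (n := 2)) ?nnegrE ?ler0n //; last by lra.
    by apply: (le_trans hj'); rewrite !expr2; nra.
  have SS : 0 <= S * S by nra.
  have h1 := ler_wpM2r SS jS; have h2 := ler_wpM2r SS S1.
  have h3 : 0 <= S * S * S by nra.
  clear -h1 h2 h3; lra.
exists tests; split=> //; rewrite szt natrM.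
have -> : 3 * (3 / 2 / t) * L + 3 * (ln 4 / t + 1) = 3 * (x + 1) by rewrite /x; field.
by apply: ler_wpM2l => //; rewrite -natr1 lerD2r truncn_le.
Qed.

Lemma testable_rank (d : nat) : (1 <= d)%N -> testable_at_rate R d (d%:R / l ^+ 2).
Proof.
case: d => [|[|[|[|[|[|[|d]]]]]]] // _; rewrite ?mulr1n.
- exact: testable1.
- exact: testable2.
- exact: testable3.
- exact: testable4.
- exact: testable5.
- exact: testable6.
- exact: (testable_large R d.+4.+1).
Qed.

End SmallRank.

(** * The error term and the final bound *)

Local Open Scope classical_set_scope.

Lemma cvg_inv_ln (R : realType) (c : R) : c / ln n%:R @[n --> \oo] --> 0.
Proof.
apply/cvgr0Pnorm_le => e e0; near=> n.
have n_ge : expR (`|c| / e + 1) <= n%:R by near: n; exact: nbhs_infty_ger.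
have n0 : 0 < n%:R :> R by apply: lt_le_trans n_ge; exact: expR_gt0.
have ln_ge : `|c| / e + 1 <= ln n%:R by rewrite -ler_expR lnK.
have ce : 0 <= `|c| / e by rewrite divr_ge0 // ltW.
have lnn0 : 0 < ln n%:R :> R by apply: lt_le_trans ln_ge; rewrite ltr_wpDl.
rewrite normrM normfV (gtr0_norm lnn0) ler_pdivrMr // mulrC -ler_pdivrMr //.
by apply: le_trans ln_ge; rewrite lerDl.
Unshelve. all: by end_near. Qed.

Theorem theorem2 (R : realType) (d : nat) (hd : (1 <= d)%N) :
  exists eps : nat -> R,
    eps @ \oo --> 0 /\
    forall (V : finType) (E : {set {set V}}),
      (forall e, e \in E -> (#|e| <= d)%N) ->
      exists tests : seq {set V},
        identifies E tests /\
        (size tests)%:R <= d%:R * log2 (expR 1) * log2 (#|E|%:R) * (1 + eps #|E|).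
Proof.
have l0 := ln2_gt0 R; have l_neq0 : ln 2 != 0 :> R by rewrite gt_eqF.
have [c hc] := testable_rank R d hd.
pose rho : R := d%:R / ln 2 ^+ 2.
have rho0 : 0 < rho by rewrite divr_gt0 ?exprn_gt0 // ltr0n.
(* Chosen so that [rho * ln n * (1 + eps n) = rho * ln n + c] for [n > 1]. *)
exists (fun n => c / rho / ln n%:R); split; first exact: cvg_inv_ln.
move=> V E rankE.
have -> : d%:R * log2 (expR 1) * log2 #|E|%:R = rho * ln #|E|%:R :> R.
  by rewrite /log2 expRK /rho; field.
have [E1|E1] := leqP #|E| 1.
  exists [::]; split; first by move=> e f eE fE _; move/card_le1_eqP: E1; apply.
  have -> : ln #|E|%:R = 0 :> R; last by rewrite mulr0 mul0r.
  by move: E1; case: #|E| => [|[|]] // _; rewrite ?ln1 ?ln0.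
have L0 : 0 < ln #|E|%:R :> R by rewrite ln_gt0 // ltr1n.
have [tests [idt szt]] := hc V E rankE E1; exists tests; split=> //.
apply: (le_trans szt); rewrite le_eqVlt; apply/orP; left; apply/eqP.
by rewrite -/rho; field; rewrite (gt_eqF L0) (gt_eqF rho0).
Qed.
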